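(* Let $x\in(0,\infty)$ and $m,n\to\infty$. If $mn^{-1/2}\to\infty$, then $$i_L^S(n,x)=n[1+o_x(1)]\quad\text{and}\quad i_G^S(n)=n[1+o(1)].$$ In addition, the following statements are true. (a) If $mn^{-2/3}\to\infty$ and $mn^{-2}\to0$, then $$i_L^S(n,x)-n=m^{-1/2}n[\theta^S(x)+o_x(1)]\quad\text{and}\quad i_G^S(n)-n=m^{-1/2}n[C_2^S/C_1^S+o(1)].$$ (b) If $mn^{-2/3}\to c$, where $c$ is a positive constant, then $$i_L^S(n,x)-n=n^{2/3}[c^{-1/2}\theta^S(x)-c^{-2}\gamma^S(x)+o_x(1)]$$ and $$i_G^S(n)-n=n^{2/3}[c^{-1/2}C_2^S/C_1^S-c^{-2}C_3^S/C_1^S+o(1)].$$ Here $\theta^S(x)=\frac{V^S(x)}{\sigma^2(x)}$ and $\gamma^S(x)=\frac{(b^S(x))^2}{\sigma^2(x)}$, with $\sigma^2(x)=F(x)(1-F(x))$, $V^S(x)=f(x)\left[\frac{x}{\pi}\right]^{1/2}$, $b^S(x)=\frac{xf'(x)}{2}$, and $$C_1^S=\int_0^\infty\sigma^2(x)e^{-ax}f(x)\,dx,\quad C_2^S=\int_0^\infty V^S(x)e^{-ax}f(x)\,dx,\quad C_3^S=\int_0^\infty (b^S(x))^2e^{-ax}f(x)\,dx.$$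
   Context: Let $X_1,X_2,\dots$ be i.i.d. random variables with values in $[0,\infty)$, with distribution function $F$ ($F(0)=0$) and density $f$. Standing assumption: $F$ is continuous, and the first and second derivatives $f=F'$ and $f'=F''$ of $F$ are continuous and bounded on $[0,\infty)$. The empirical distribution function is $F_n(x)=\frac1n\sum_{i=1}^n \mathbb{I}(X_i\le x)$, where $\mathbb{I}$ is the indicator function. For $m\in\mathbb{N}$, $m\geq 1$, $k\in\{0,1,2,\dots\}$ and $x\ge 0$ let $V_{k,m}(x)=e^{-mx}\frac{(mx)^k}{k!}$ (with $0^0=1$). The Szasz estimator is $\hat F^S_{m,n}(x)=\sum_{k=0}^\infty F_n\left(\frac km\right)V_{k,m}(x)$; the parameter $m$ may depend on $n$. Fix a constant $a\in(0,\infty)$. For an estimator $\hat F$ of $F$ (either $\hat F^S_{m,n}$ or the empirical distribution function $F_k$ based on $k$ observations) put $\operatorname{MSE}[\hat F(x)]=\mathbb{E}[(\hat F(x)-F(x))^2]$ and $\operatorname{MISE}[\hat F]=\mathbb{E}\left[\int_0^\infty(\hat F(x)-F(x))^2e^{-ax}f(x)\,dx\right]$. The local and global numbers of observations that the empirical distribution function needs to perform at least as well as $\hat F^S_{m,n}$ are $$i_L^S(n,x)=\min\left\{k\in\mathbb{N}:\operatorname{MSE}[F_k(x)]\le\operatorname{MSE}[\hat F^S_{m,n}(x)]\right\},\quad i_G^S(n)=\min\left\{k\in\mathbb{N}:\operatorname{MISE}[F_k]\le\operatorname{MISE}[\hat F^S_{m,n}]\right\}.$$ The notation $u=o(v)$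 means $\lim|u/v|=0$ as $m,n\to\infty$; a subscript as in $o_x$ indicates that the rate of convergence may depend on $x$.
   Formalization: The claims on i_L^S(n,x) are proved for x with 0 < F(x) < 1; if F(x) is 0 or 1, then MSE[F_k(x)] = 0 for all k, so i_L^S(n,x) = 1 and θ^S(x), γ^S(x) are undefined, and the claims as stated fail. *)

(* Defs.v *)
From mathcomp Require Import all_boot all_order all_algebra finmap.
From mathcomp Require Import all_classical all_reals all_analysis.

Set Implicit Arguments.
Unset Strict Implicit.
Unset Printing Implicit Defensive.
Import Order.TTheory GRing.Theory Num.Theory.
Import numFieldNormedType.Exports.

Local Open Scope classical_set_scope.
Local Open Scope ring_scope.

Section sampling.
Context d (T : measurableType d) (R : realType) (P : probability T R).

Definition mutually_independent (X : nat -> {RV P >-> R}) : Prop :=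
  forall (J : {fset nat}) (A : nat -> set R), (forall i, measurable (A i)) ->
    P (\bigcap_(i in [set` J]) (X i @^-1` A i)) =
    (\prod_(i <- J) P (X i @^-1` A i))%E.

Definition iid_with_cdf (X : nat -> {RV P >-> R}) (F : R -> R) : Prop :=
  mutually_independent X /\ (forall i x, cdf (X i) x = (F x)%:E).

(* [X 0, ..., X n.-1] are the first [n] observations. *)
Definition ecdf (X : nat -> {RV P >-> R}) (n : nat) (w : T) (x : R) : R :=
  n%:R^-1 * \sum_(i < n) (X i w <= x)%R%:R.

Definition szasz_weight (m k : nat) (x : R) : R :=
  expR (- (m%:R * x)) * (m%:R * x) ^+ k / k`!%:R.

Definition szasz (X : nat -> {RV P >-> R}) (m n : nat) (w : T) (x : R) : R :=
  limn (series (fun k => ecdf X n w (k%:R / m%:R) * szasz_weight m k x)).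

Definition MSE (est : T -> R -> R) (F : R -> R) (x : R) : \bar R :=
  'E_P[fun w => (est w x - F x) ^+ 2].

Definition MISE (est : T -> R -> R) (F f : R -> R) (a : R) : \bar R :=
  'E_P[fun w => \int[lebesgue_measure]_(x in `[0, +oo[)
                  ((est w x - F x) ^+ 2 * expR (- (a * x)) * f x)].

End sampling.

(* The least element of [S]; [0] if [S] is empty. *)
Definition nat_min (S : set nat) : nat := xget 0%N (S `&` lbound S).

(* The empirical distribution function needs at least one observation, whence
   [0 < k]; the value [0] of the deficiencies below thus means that no number
   of observations is sufficient. *)
Section deficiency.
Context d (T : measurableType d) (R : realType) (P : probability T R).
Variables (X : nat -> {RV P >-> R}) (F f : R -> R) (a : R).

Definition iL (m n : nat) (x : R) : nat :=
  nat_min [set k | (0 < k)%N /\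
    (MSE P (ecdf X k) F x <= MSE P (szasz X m n) F x)%E].

Definition iG (m n : nat) : nat :=
  nat_min [set k | (0 < k)%N /\
    (MISE P (ecdf X k) F f a <= MISE P (szasz X m n) F f a)%E].

End deficiency.

Section analytic.
Context (R : realType).

(* One-sided at [0], since [F] vanishes on the negative half-line and need not
   be differentiable at [0] as a function on the whole line. *)
Definition halfline_derivative (g g' : R -> R) : Prop :=
  forall x, 0 <= x ->
    (g y - g x) / (y - x) @[y --> within `[0, +oo[ x^'] --> g' x.

Definition halfline_cont_bounded (g : R -> R) : Prop :=
  {within `[0, +oo[, continuous g} /\ [bounded g x | x in `[0, +oo[].

Definition sigma2 (F : R -> R) (x : R) : R := F x * (1 - F x).
Definition VS (f : R -> R) (x : R) : R := f x * Num.sqrt (x / pi).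
Definition bS (f' : R -> R) (x : R) : R := x * f' x / 2.

Definition thetaS (F f : R -> R) (x : R) : R := VS f x / sigma2 F x.
Definition gammaS (F f' : R -> R) (x : R) : R := bS f' x ^+ 2 / sigma2 F x.

Definition weighted_integral (f : R -> R) (a : R) (g : R -> R) : R :=
  \int[lebesgue_measure]_(x in `[0, +oo[) (g x * expR (- (a * x)) * f x).

Definition C1S (F f : R -> R) (a : R) : R := weighted_integral f a (sigma2 F).
Definition C2S (f : R -> R) (a : R) : R := weighted_integral f a (VS f).
Definition C3S (f f' : R -> R) (a : R) : R :=
  weighted_integral f a (fun x => bS f' x ^+ 2).

(* [u n = s n * [l + o(1)]] as [n] tends to infinity *)
Definition equals_scaled_o1 (u s : nat -> R) (l : R) : Prop :=
  exists2 e : nat -> R, e @ \oo --> 0 &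
    \forall n \near \oo, u n = s n * (l + e n).

End analytic.

(* Main.v *)
Require Import Defs.
From mathcomp Require Import all_boot all_order all_algebra finmap.
From mathcomp Require Import all_classical all_reals all_analysis.
From mathcomp Require Import measurable_realfun.
From mathcomp Require Import ring lra zify.
Set Implicit Arguments.
Unset Strict Implicit.
Unset Printing Implicit Defensive.
Import Order.TTheory GRing.Theory Num.Theory.
Import numFieldNormedType.Exports.
Local Open Scope classical_set_scope.
Local Open Scope ring_scope.

(* The Szasz estimator is an average of n i.i.d. copies of P(N >= m X), where N
   is Poisson with mean m x and independent of X. Hence its mean squared error is
   (M2 - M1 ^ 2) / n + (M1 - F x) ^ 2 with M1 = E F(K / m) and
   M2 = E F(min(K, L) / m), for K, L independent Poisson variables with mean m x.
   Taylor expansion gives M1 - F x ~ x f'(x) / (2 m), and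
   F x - M2 ~ f(x) E|K - L| / (2 m). Given K + L = s, the difference K - L is a
   simple random walk after s steps, whose mean distance from the origin is an
   explicit central binomial coefficient; Wallis' inequalities then show that
   E|K - L| = 2 sqrt(m x / pi) + O(1), so that F x - M2 ~ V(x) / sqrt m. All
   bounds are polynomial in x, so dominated convergence against exp(-a x) f(x)
   gives the same expansions for the MISE (with Fubini). Finally, the least k with
   s / k <= A / n + B is s / (A / n + B) up to an error of at most 1. *)

(** * Poisson sums and moments *)

(** A normal approximation would give the leading order of E|K - L|; the exact walk formula is
    preferred because its error is bounded uniformly in m and x, and an explicit dependence on x is
    what domination under the weighted integral asks for. Replacing M1 ^ 2 by F x ^ 2 in the
    variance costs O(1 / m), which is negligible after multiplication by sqrt m. The regimes come
    from comparing V / sqrt m with n b / m ^ 2: the two balance when m is of order n ^ (2 / 3). In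
    the variance-dominated regime, m / n ^ 2 -> 0 says that a rounding error of at most 1 is small
    compared with n / sqrt m. No probability space carries K and L. Their laws occur only as weights
    of partial sums, whose limits play the role of expectations; the interchange with the
    expectation over the sample is bounded convergence. *)

Section poisson.
Context {R : realType}.
Implicit Types (l s t : R) (g h : nat -> R) (N : nat).

(** With [l] equal to [m%:R * x] this is convertible to [szasz_weight m k x]. *)
Definition pois l (k : nat) : R := expR (- l) * l ^+ k / k`!%:R.

(** Poisson expectations are phrased as convergence of these partial sums to a given value, so that
    summability and value travel in one hypothesis. *)
Definition psum l g N : R := \sum_(0 <= k < N) g k * pois l k.

Lemma pois_ge0 l k : 0 <= l -> 0 <= pois l k.
Proof. by move=> l0; rewrite /pois !mulr_ge0 ?expR_ge0 ?exprn_ge0 ?invr_ge0. Qed.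

Lemma pois_succ l k : k.+1%:R * pois l k.+1 = l * pois l k.
Proof.
rewrite /pois factS natrM exprS.
have k0 : k.+1%:R != 0 :> R by rewrite pnatr_eq0.
have f0 : k`!%:R != 0 :> R by rewrite pnatr_eq0 -lt0n fact_gt0.
by field; rewrite f0 nat1r.
Qed.

Lemma psum_nd l g : 0 <= l -> (forall k, 0 <= g k) ->
  nondecreasing_seq (psum l g).
Proof.
move=> l0 g0; apply/nondecreasing_seqP => n.
by rewrite /psum big_nat_recr//= lerDl mulr_ge0 ?pois_ge0.
Qed.

Lemma psum_le_lim l g s N : 0 <= l -> (forall k, 0 <= g k) ->
  psum l g @ \oo --> s -> psum l g N <= s.
Proof.
move=> l0 g0 gs; rewrite -(cvg_lim _ gs)//.
by apply: nondecreasing_cvgn_le; [exact: psum_nd|apply/cvg_ex; exists s].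
Qed.

Lemma psumE l g h : g =1 h -> psum l g = psum l h.
Proof. by move=> gh; congr psum; exact/funext. Qed.

Lemma psum_eq l g h s t : g =1 h -> s = t ->
  psum l g @ \oo --> s -> psum l h @ \oo --> t.
Proof. by move=> /psumE -> ->. Qed.

Lemma psumD l g h s t : psum l g @ \oo --> s -> psum l h @ \oo --> t ->
  psum l (fun k => g k + h k) @ \oo --> s + t.
Proof.
move=> gs ht.
rewrite (_ : psum l _ = psum l g \+ psum l h); first exact: cvgD.
apply/funext => N; rewrite /psum/= -big_split/=.
by apply: eq_bigr => i _; rewrite mulrDl.
Qed.

Lemma psumZ l g c s : psum l g @ \oo --> s ->
  psum l (fun k => c * g k) @ \oo --> c * s.
Proof.
move=> gs.
rewrite (_ : psum l _ = fun N => c * psum l g N); first exact: cvgMr.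
apply/funext => N; rewrite /psum/= mulr_sumr.
by apply: eq_bigr => i _; rewrite mulrA.
Qed.

Lemma psum_cst1 l : psum l (fun=> 1) @ \oo --> (1 : R).
Proof.
rewrite (_ : psum l _ = fun N => expR (- l) * series (exp_coeff l) N).
  rewrite [X in _ --> X](_ : _ = expR (- l) * expR l).
    by apply: cvgMr; exact: is_cvg_series_exp_coeff.
  by rewrite -expRD addNr expR0.
apply/funext => N; rewrite /psum/= mulr_sumr.
by apply: eq_bigr => i _; rewrite mul1r /pois /exp_coeff/= mulrA.
Qed.

Lemma psum_cst l c : psum l (fun=> c) @ \oo --> c.
Proof.
rewrite -[X in _ --> X]mulr1 (psumE _ (h := fun=> c * 1)); last by move=> k; rewrite mulr1.
exact/psumZ/psum_cst1.
Qed.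

(* [k * pois l k = l * pois l k.-1] *)
Lemma psum_shift l g s : psum l g @ \oo --> s ->
  psum l (fun k => k%:R * g k.-1) @ \oo --> l * s.
Proof.
move=> gs; rewrite -cvg_shiftS /=.
rewrite (_ : (fun n => _) = (fun N => l * psum l g N)); first exact: cvgMr.
apply/funext => N; rewrite /psum big_nat_recl//= !mul0r add0r mulr_sumr.
apply: eq_bigr => i _.
by rewrite mulrAC pois_succ/=; ring.
Qed.

Lemma psum_dominated l g h : 0 <= l -> (forall k, `|g k| <= h k) ->
  cvgn (psum l h) -> cvgn (psum l g).
Proof.
move=> l0 gh ch; apply: (@normed_cvg R R (fun k => g k * pois l k)).
apply: (@series_le_cvg _ _ (fun k => h k * pois l k)) => // k /=.
- exact: normr_ge0.
- by rewrite mulr_ge0 ?pois_ge0// (le_trans _ (gh k)).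
- by rewrite normrM (ger0_norm (pois_ge0 _ _))// ler_wpM2r ?pois_ge0.
Qed.

Lemma psum_norm_le l g h s t : 0 <= l -> (forall k, `|g k| <= h k) ->
  psum l g @ \oo --> s -> psum l h @ \oo --> t -> `|s| <= t.
Proof.
move=> l0 gh gs ht.
apply: (ler_cvg_to (cvg_norm gs) ht).
near=> N; rewrite /psum (le_trans (ler_norm_sum _ _ _))//.
apply: ler_sum => k _.
by rewrite normrM (ger0_norm (pois_ge0 _ _))// ler_wpM2r ?pois_ge0.
Unshelve. all: by end_near. Qed.

(** The falling factorial, with the subtraction taken in [R]: [ring] then sees a polynomial in [k],
    and the factor for [i = k] makes it vanish when [k < j]. *)
Definition ffact_real (k j : nat) : R := \prod_(i < j) (k%:R - i%:R).

(** Factorial moments of the Poisson law: each use of [psum_shift] multiplies by [l] and turns the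
    falling factorial of length [j] at [k.-1] into the one of length [j.+1] at [k]. *)
Lemma psum_ffact_real l j : psum l (ffact_real^~ j) @ \oo --> l ^+ j.
Proof.
elim: j => [|j /psum_shift].
  apply: psum_eq (@psum_cst1 l); last by rewrite expr0.
  by move=> k; rewrite /ffact_real big_ord0.
(* At [k = 0] the truncated [k.-1] is 0 rather than -1, but both sides carry a factor 0. *)
rewrite -exprS; apply: psum_eq => // -[|k].
  by rewrite mul0r /ffact_real big_ord_recl subr0 mul0r.
rewrite /ffact_real big_ord_recl subr0; congr (_ * _); apply: eq_bigr => i _.
by rewrite /= /bump/= -natr1 natrD; ring.
Qed.

Lemma psum_mean l : psum l (fun k => k%:R) @ \oo --> l.
Proof.
apply: psum_eq (@psum_ffact_real l 1) => [k|]; last by rewrite expr1.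
by rewrite /ffact_real big_ord1 subr0.
Qed.

Lemma psum_var l : psum l (fun k => (k%:R - l) ^+ 2) @ \oo --> l.
Proof.
have := (psumD (@psum_ffact_real l 2)
  (psumD (psumZ (c := 1 - 2 * l) (@psum_ffact_real l 1)) (@psum_cst l (l ^+ 2)))).
apply: psum_eq.
  by move=> k; rewrite /ffact_real !(big_ord_recr, big_ord0)/=; ring.
by ring.
Qed.

(** The coefficients are those of (k - l) ^ 4 in the basis of falling factorials; their constant
    terms 6, 7, 1 are Stirling numbers of the second kind. *)
Lemma psum_moment4 l :
  psum l (fun k => (k%:R - l) ^+ 4) @ \oo --> 3 * l ^+ 2 + l.
Proof.
have := (psumD (@psum_ffact_real l 4)
  (psumD (psumZ (c := 6 - 4 * l) (@psum_ffact_real l 3))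
  (psumD (psumZ (c := 7 - 12 * l + 6 * l ^+ 2) (@psum_ffact_real l 2))
  (psumD (psumZ (c := 1 - 4 * l + 6 * l ^+ 2 - 4 * l ^+ 3) (@psum_ffact_real l 1))
     (@psum_cst l (l ^+ 4)))))).
apply: psum_eq.
  by move=> k; rewrite /ffact_real !(big_ord_recr, big_ord0)/=; ring.
by ring.
Qed.

End poisson.

(** * Independent Poisson variables and the simple random walk *)

Section abs_difference.
Context {R : realType}.
Implicit Types (l : R) (N : nat).

(** Partial sums over squares make product functions factor ([psum2_prod]); the law of K + L is
    instead read off along diagonals, hence the comparison of squares with triangles below. *)
Definition psum2 l (h : nat -> nat -> R) N : R :=
  \sum_(0 <= i < N) \sum_(0 <= j < N) h i j * (pois l i * pois l j).

Lemma triangular_sum (G : nat -> nat -> R) N :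
  \sum_(0 <= s < N) \sum_(0 <= i < s.+1) G i (s - i)%N =
  \sum_(0 <= i < N) \sum_(0 <= j < N - i) G i j.
Proof.
elim: N => [|N IH]; first by rewrite !big_nil.
rewrite big_nat_recr//= IH [RHS]big_nat_recr//= subSn// subnn big_nat1.
rewrite [X in _ + X = _]big_nat_recr//= subnn addrA; congr (_ + _).
rewrite -big_split/=; apply: eq_big_nat => i /andP[_ iN].
by rewrite subSn ?(ltnW iN)// big_nat_recr.
Qed.

Lemma triangular_sum_le_square (G : nat -> nat -> R) N :
  (forall i j, 0 <= G i j) ->
  \sum_(0 <= s < N) \sum_(0 <= i < s.+1) G i (s - i)%N <=
  \sum_(0 <= i < N) \sum_(0 <= j < N) G i j.
Proof.
move=> G0; rewrite triangular_sum; apply: ler_sum => i _.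
rewrite [leRHS](@big_cat_nat _ _ _ (N - i)%N)//=; last exact: leq_subr.
by rewrite lerDl sumr_ge0.
Qed.

Lemma square_sum_le_triangular (G : nat -> nat -> R) N :
  (forall i j, 0 <= G i j) ->
  \sum_(0 <= i < N) \sum_(0 <= j < N) G i j <=
  \sum_(0 <= s < N + N) \sum_(0 <= i < s.+1) G i (s - i)%N.
Proof.
move=> G0; rewrite triangular_sum [leRHS](@big_cat_nat _ _ _ N)//=; last exact: leq_addr.
rewrite -[leLHS]addr0 lerD//; last first.
  by rewrite sumr_ge0// => i _; rewrite sumr_ge0.
rewrite !big_nat; apply: ler_sum => i /andP[_ iN].
rewrite [leRHS](@big_cat_nat _ _ _ N)//=; last by rewrite -addnBA ?leq_addr// ltnW.
by rewrite lerDl sumr_ge0.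
Qed.

(** In probabilistic terms: K + L is Poisson with mean [2 * l], and given K + L = s the variable K
    is binomial with parameters s and 1/2. *)
Lemma pois_mul l i s : (i <= s)%N ->
  pois l i * pois l (s - i) = 'C(s, i)%:R / 2 ^+ s * pois (2 * l) s.
Proof.
move=> si; rewrite /pois exprMn mulrDl mul1r opprD expRD.
have f k : k`!%:R != 0 :> R by rewrite pnatr_eq0 -lt0n fact_gt0.
have -> : l ^+ s = l ^+ i * l ^+ (s - i) by rewrite -exprD subnKC.
rewrite -(bin_fact si) 2!natrM.
have : 'C(s, i)%:R != 0 :> R by rewrite pnatr_eq0 -lt0n bin_gt0.
have := f i; have := f (s - i)%N; have : (2 ^+ s) != 0 :> R by rewrite expf_neq0.
by move=> h1 h2 h3 h4; field; rewrite h1 h2 h3 h4.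
Qed.

(* The mean distance from the origin of the simple random walk after [s] steps. *)
Definition walk_dist (s : nat) : R :=
  \sum_(0 <= i < s.+1) `|i%:R - (s - i)%N%:R| * ('C(s, i)%:R / 2 ^+ s).

Lemma triangular_abs l N :
  \sum_(0 <= s < N) \sum_(0 <= i < s.+1)
    `|i%:R - (s - i)%N%:R| * (pois l i * pois l (s - i)) =
  psum (2 * l) walk_dist N.
Proof.
apply: eq_bigr => s _; rewrite /walk_dist mulr_suml !big_nat.
by apply: eq_bigr => i /andP[_]; rewrite ltnS => si; rewrite pois_mul// mulrA.
Qed.

Lemma psum2_abs_cvg l (t : R) : 0 <= l -> psum (2 * l) walk_dist @ \oo --> t ->
  psum2 l (fun i j => `|i%:R - j%:R|) @ \oo --> t.
Proof.
move=> l0 wt.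
have G0 i j : 0 <= `|i%:R - j%:R| * (pois l i * pois l j) :> R.
  by apply: mulr_ge0 => //; apply: mulr_ge0; exact: pois_ge0.
apply: (@squeeze_cvgr _ _ _ _ (psum (2 * l) walk_dist)
    (fun N => psum (2 * l) walk_dist (N + N)%N)) => //.
- near=> N; apply/andP; split; rewrite -triangular_abs.
    exact: (triangular_sum_le_square _ G0).
  exact: (square_sum_le_triangular _ G0).
- apply: cvg_comp wt.
  apply/cvgnyPge => A; exists A => // n /= An; exact: leq_trans (leq_addr _ _).
Unshelve. all: by end_near. Qed.

(** The sum telescopes, since (s - 2 i) C(s, i) = (i + 1) C(s, i + 1) - i C(s, i). For [r = s.+1] it
    gives 0. *)
Lemma signed_bin_sum (s r : nat) :
  \sum_(0 <= i < r) (s%:R - i%:R - i%:R) * 'C(s, i)%:R = r%:R * 'C(s, r)%:R :> R.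
Proof.
elim: r => [|r IH]; first by rewrite big_nil mul0r.
rewrite big_nat_recr//= IH -mulrDl.
rewrite -natrM mul_bin_left natrM addrC subrK.
by have [rs|sr] := leqP r s; [rewrite natrB | rewrite bin_small// !mulr0].
Qed.

(** The sign of s - 2 i changes at [uphalf s]. The whole signed sum is 0, so the two halves are
    opposite and the sum of absolute values is twice the first half, which [signed_bin_sum]
    evaluates. *)
Lemma walk_distE (s : nat) :
  walk_dist s = 2 * (uphalf s)%:R * 'C(s, uphalf s)%:R / 2 ^+ s.
Proof.
have us : (uphalf s <= s)%N by lia.
transitivity ((\sum_(0 <= i < uphalf s) (s%:R - i%:R - i%:R) * 'C(s, i)%:R -
  \sum_(uphalf s <= i < s.+1) (s%:R - i%:R - i%:R) * 'C(s, i)%:R) / 2 ^+ s : R).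
  rewrite /walk_dist (@big_cat_nat _ _ _ (uphalf s))//=; last exact: leqW.
  rewrite mulrBl !mulr_suml -sumrN !big_nat; congr (_ + _); apply: eq_bigr => i.
    move=> /andP[_ iu]; rewrite -mulrA; congr (_ * _).
    rewrite distrC ger0_norm ?subr_ge0 ?ler_nat; last lia.
    by rewrite natrB//; lia.
  move=> /andP[ui si]; rewrite -!mulNr -mulrA; congr (_ * _).
  rewrite ger0_norm ?subr_ge0 ?ler_nat; last lia.
  by rewrite natrB; [ring|lia].
have := signed_bin_sum s s.+1; rewrite (@big_cat_nat _ _ _ (uphalf s))//=; last exact: leqW.
rewrite bin_small// mulr0 => /eqP; rewrite addrC addr_eq0 => /eqP ->.
by rewrite opprK signed_bin_sum; congr (_ / _); ring.
Qed.

(** The probability that the simple random walk is at the origin after [j.*2] steps. *)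
Definition central_bin (j : nat) : R := 'C(j.*2, j)%:R / 4 ^+ j.

Lemma central_bin0 : central_bin 0 = 1.
Proof. by rewrite /central_bin bin0 expr0 divr1. Qed.

Lemma bin_doubleS j : 'C(j.+1.*2, j.+1) = (2 * 'C(j.*2.+1, j.+1))%N.
Proof.
rewrite doubleS binS -(@bin_sub j.*2.+1 j); last lia.
by rewrite (_ : (j.*2.+1 - j)%N = j.+1); lia.
Qed.

Lemma central_binS j : 
  central_bin j.+1 = central_bin j * (j.*2.+1%:R / j.*2.+2%:R).
Proof.
have : (j.+1 * 'C(j.+1.*2, j.+1) = 2 * (j.*2.+1 * 'C(j.*2, j)))%N.
  by rewrite bin_doubleS mulnCA (mul_bin_diag j.*2.+1 j).
move/(congr1 (fun k => k%:R : R)); rewrite !natrM => h.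
rewrite /central_bin exprS.
have p : (4 : R) ^+ j != 0 by rewrite expf_neq0.
have -> : j.*2.+2%:R = 2 * j.+1%:R :> R by rewrite -doubleS -mul2n natrM.
have j0 : j.+1%:R != 0 :> R by rewrite pnatr_eq0.
apply: (mulfI j0); rewrite mulrA h.
by field; rewrite p nat1r j0.
Qed.

Lemma walk_dist_double j : walk_dist j.*2 = 2 * j%:R * central_bin j.
Proof.
by rewrite walk_distE uphalf_double /central_bin -mul2n exprM mulrA -natrX.
Qed.

(** At an odd time the walk is away from the origin, so one more step changes its distance by 1 or
    -1 with equal chance. The proof compares the closed forms. Odd times thus reduce to even
    ones. *)
Lemma walk_dist_doubleS j : walk_dist j.*2.+1 = walk_dist j.+1.*2.
Proof.
rewrite walk_dist_double walk_distE /= doubleK /central_bin.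
rewrite bin_doubleS natrM -[4]/((2 * 2)%:R) natrM -expr2 -exprM mul2n doubleS [_ ^+ j.*2.+2]exprS.
have p : (2 : R) ^+ (j.*2.+1) != 0 by rewrite expf_neq0.
by field.
Qed.
End abs_difference.

(** * Wallis' inequalities *)

Lemma integrableZ_EFin d (T : measurableType d) (R : realType)
    (mu : measure T R) (D : set T) (k : R) (g : T -> R) :
  measurable D -> mu.-integrable D (EFin \o g) ->
  mu.-integrable D (EFin \o (fun x => k * g x)).
Proof.
move=> mD ig; rewrite (_ : _ \o _ = (fun x => k%:E * (EFin \o g) x)%E).
  exact: integrableZl.
by apply/funext => x; rewrite /= EFinM.
Qed.

Section wallis.
Context {R : realType}.

Local Notation D := (`[0, pi / 2]%classic : set R).
Definition sin_integral n : R := \int[lebesgue_measure]_(x in D) (sin x ^+ n).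

Let pihalf_gt0 : 0 < pi / 2 :> R. Proof. by rewrite divr_gt0 ?pi_gt0. Qed.

Let sin_ge0D x : D x -> 0 <= sin x.
Proof.
rewrite /D /= in_itv/= => /andP[x0 xpi]; apply: sin_ge0_pi.
by rewrite x0 (le_trans xpi)// ler_pdivrMr// ler_peMr ?pi_ge0// ler1n.
Qed.

Lemma is_derive_continuous (g : R -> R) (x dg : R) :
  is_derive x 1 g dg -> {for x, continuous g}.
Proof. by move=> [/derivable1_diffP/differentiable_continuous]. Qed.

Lemma is_derive_sinX n (x : R) :
  is_derive x 1 (fun x => sin x ^+ n) (n%:R * sin x ^+ n.-1 * cos x).
Proof.
have := is_deriveX n (is_derive_sin x).
by rewrite (_ : sin ^+ n = fun x => sin x ^+ n)//; apply/funext => y; rewrite exprfctE.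
Qed.

Let sinX_integrable n :
  lebesgue_measure.-integrable D (EFin \o (fun x => sin x ^+ n)).
Proof.
apply: continuous_compact_integrable; first exact: segment_compact.
by apply: derivable_within_continuous => x _; have [] := is_derive_sinX n x.
Qed.

Lemma sin_integral_succ n : sin_integral n.+1 <= sin_integral n.
Proof.
apply: le_Rintegral => //; try exact: sinX_integrable.
by move=> x Dx /=; rewrite exprS ler_piMl ?exprn_ge0 ?sin_ge0D// sin_le1.
Qed.

Lemma sin_integral0 : sin_integral 0 = pi / 2.
Proof.
rewrite /sin_integral; under eq_Rintegral do rewrite expr0.
rewrite Rintegral_cst// mul1r.
have /= := @lebesgue_measure_itv R `[0, pi / 2]%R.
by rewrite lte_fin pihalf_gt0 oppr0 adde0 => /(congr1 fine).
Qed.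

Lemma sin_integral1 : sin_integral 1 = 1.
Proof.
rewrite /sin_integral /Rintegral.
rewrite (@continuous_FTC2 _ _ (fun x => - cos x))//=.
- by rewrite cos_pihalf cos0 oppr0 opprK add0r.
- by apply: derivable_within_continuous => x _; have [] := is_derive_sinX 1 x.
- have dc (x : R) : is_derive x 1 (fun x => - cos x) (sin x).
    by rewrite -[X in is_derive _ _ _ X]opprK; apply: is_deriveN.
  split.
  + by move=> x _; have [] := dc x.
  + by apply: cvg_at_right_filter; exact: is_derive_continuous (dc _).
  + by apply: cvg_at_left_filter; exact: is_derive_continuous (dc _).
- move=> x _; rewrite expr1 derive1E.
  by rewrite (@derive_val _ _ _ _ _ _ (- - sin x)) ?opprK.
Qed.

(** In place of integration by parts: sin ^ (n + 1) cos vanishes at both ends of the interval, so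
    its derivative has integral 0. *)
Lemma sin_integral_rec n :
  n.+2%:R * sin_integral n.+2 = n.+1%:R * sin_integral n.
Proof.
pose G (x : R) := sin x ^+ n.+1 * cos x.
(* The derivative (n + 1) sin ^ n cos ^ 2 - sin ^ (n + 2), rewritten with cos ^ 2 = 1 - sin ^ 2. *)
pose g (x : R) := n.+1%:R * sin x ^+ n - n.+2%:R * sin x ^+ n.+2.
have dG (x : R) : is_derive x 1 G (g x).
  have := is_deriveM (is_derive_sinX n.+1 x) (is_derive_cos x).
  rewrite (_ : _ *: _ + _ = g x)//.
  rewrite /g /GRing.scale/= mulrN mulrCA -mulrA -expr2 cos2sin2.
  rewrite -!exprSr -!natr1 !exprS; ring.
have cG x : {for x, continuous G}.
  exact: is_derive_continuous (dG x).
have : \int[lebesgue_measure]_(x in D) (g x) = 0.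
  rewrite /Rintegral (@continuous_FTC2 _ _ G)//=.
  - by rewrite /G cos_pihalf sin0 mulr0 expr0n/= mul0r subr0.
  - apply: continuous_subspaceT => x; rewrite /g.
    have c k : {for x, continuous (fun x : R => sin x ^+ k)}.
      exact: is_derive_continuous (is_derive_sinX k x).
    by apply: cvgB; apply: cvgMr; exact: c.
  - split; first by move=> x _; have [] := dG x.
    + by apply: cvg_at_right_filter; exact: cG.
    + by apply: cvg_at_left_filter; exact: cG.
  - by move=> x _; rewrite derive1E; apply: derive_val.
rewrite /g RintegralB//; last 2 first.
- by apply: integrableZ_EFin => //; exact: sinX_integrable.
- by apply: integrableZ_EFin => //; exact: sinX_integrable.
rewrite !RintegralZl//; try exact: sinX_integrable.
by move/eqP; rewrite subr_eq0 => /eqP <-.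
Qed.

Lemma sin_integral_double j : sin_integral j.*2 = central_bin j * (pi / 2).
Proof.
elim: j => [|j IH]; first by rewrite sin_integral0 central_bin0 mul1r.
have h := sin_integral_rec j.*2.
have n0 : j.*2.+2%:R != 0 :> R by rewrite pnatr_eq0.
apply: (mulfI n0); rewrite doubleS h IH central_binS.
by field.
Qed.

(** The product does not depend on [j]: the factor (2 j + 2) / (2 j + 3) gained by the integral
    cancels the one gained by the first two factors. *)
Lemma sin_integral_doubleS j :
  j.*2.+1%:R * central_bin j * sin_integral j.*2.+1 = 1.
Proof.
elim: j => [|j IH]; first by rewrite sin_integral1 central_bin0 !mul1r.
have h := sin_integral_rec j.*2.+1.
rewrite -[RHS]IH central_binS doubleS.
transitivity (j.*2.+3%:R * sin_integral j.*2.+3 *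
    (central_bin j * (j.*2.+1%:R / j.*2.+2%:R))); first by ring.
by rewrite h; field; rewrite -natrD pnatr_eq0.
Qed.

Lemma central_bin_gt0 j : 0 < central_bin j :> R.
Proof. by rewrite /central_bin divr_gt0 ?exprn_gt0// ltr0n bin_gt0 -addnn leq_addr. Qed.

Lemma central_bin_le1 j : central_bin j <= 1 :> R.
Proof.
elim: j => [|j IH]; first by rewrite central_bin0.
rewrite central_binS mulr_ile1 ?(ltW (central_bin_gt0 _))//.
by rewrite ler_pdivrMr// mul1r ler_nat.
Qed.

(** Both Wallis bounds compare an even sine integral, which is [central_bin] times pi / 2, with the
    odd one just below or just above it, which is a reciprocal of [central_bin]. Here the indices
    are 2 j + 1 and 2 j + 2; the lower bound uses 2 j and 2 j + 1. *)
Lemma wallis_ub j : j%:R * central_bin j ^+ 2 <= pi^-1 :> R.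
Proof.
case: j => [|j]; first by rewrite mul0r invr_ge0 pi_ge0.
have := sin_integral_succ j.*2.+1; rewrite -doubleS sin_integral_double => W.
have h : j.*2.+2%:R * central_bin j.+1 * sin_integral j.*2.+1 = 1.
  by rewrite -[RHS](sin_integral_doubleS j) central_binS; field; rewrite -natrD pnatr_eq0.
rewrite -div1r ler_pdivlMr ?pi_gt0// -[leRHS]h.
rewrite (_ : _ * pi = j.*2.+2%:R * central_bin j.+1 * (central_bin j.+1 * (pi / 2))).
  by rewrite ler_wpM2l// mulr_ge0// ltW// central_bin_gt0.
by rewrite -doubleS -mul2n natrM; field.
Qed.

Lemma wallis_lb j : pi^-1 <= (j%:R + 2^-1) * central_bin j ^+ 2 :> R.
Proof.
have := sin_integral_succ j.*2; rewrite sin_integral_double => W.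
rewrite -div1r ler_pdivrMr ?pi_gt0// -[leLHS](sin_integral_doubleS j).
rewrite (_ : _ * pi = j.*2.+1%:R * central_bin j * (central_bin j * (pi / 2))).
  by rewrite ler_wpM2l// mulr_ge0// ltW// central_bin_gt0.
by rewrite -[j.*2.+1%:R]natr1 -mul2n natrM; field.
Qed.

(** With c = [central_bin j] the distance is 2 j c. Its square is at most 4 j / pi by [wallis_ub],
    while [wallis_lb] gives 4 j / pi <= (2 j c) ^ 2 + 2 j c ^ 2, which is below (2 j c + 1) ^ 2
    because c <= 1. *)
Lemma walk_dist_double_bound j :
  `|walk_dist j.*2 - Num.sqrt (4 * j%:R / pi)| <= 1 :> R.
Proof.
have c0 := ltW (central_bin_gt0 j); have c1 := central_bin_le1 j.
have ub := wallis_ub j; have lb := wallis_lb j.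
have pi0 : 0 < pi :> R := pi_gt0 R.
set c := central_bin j in c0 c1 ub lb *.
have j0 : 0 <= j%:R :> R by [].
have w0 : 0 <= 2 * j%:R * c by rewrite !mulr_ge0.
have ubw : 2 * j%:R * c <= Num.sqrt (4 * j%:R / pi).
  rewrite -(ger0_norm w0) -sqrtr_sqr ler_wsqrtr//; nra.
have lbw : Num.sqrt (4 * j%:R / pi) <= 2 * j%:R * c + 1.
  have w1 : 0 <= 2 * j%:R * c + 1 by rewrite addr_ge0.
  rewrite -(ger0_norm w1) -sqrtr_sqr ler_wsqrtr//.
  have : 4 * j%:R * pi^-1 <= 4 * j%:R * ((j%:R + 2^-1) * c ^+ 2).
    by rewrite ler_wpM2l// mulr_ge0.
  have : j%:R * c * c <= j%:R * c * 1 by rewrite ler_wpM2l// mulr_ge0.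
  nra.
by rewrite walk_dist_double -/c ler_norml; apply/andP; split; lra.
Qed.

Lemma sqrtr_add_le1 (u v : R) : 0 <= u -> 0 <= v -> v <= 1 ->
  Num.sqrt u <= Num.sqrt (u + v) <= Num.sqrt u + 1.
Proof.
move=> u0 v0 v1; rewrite ler_wsqrtr ?lerDl//=.
have w1 : 0 <= Num.sqrt u + 1 by rewrite addr_ge0.
rewrite -[leRHS](ger0_norm w1) -sqrtr_sqr ler_wsqrtr//.
by rewrite sqrrD sqr_sqrtr// expr1n mulr1 -addrA lerD2l -[leLHS]add0r lerD.
Qed.

Lemma walk_dist_bound s : `|walk_dist s - Num.sqrt (2 * s%:R / pi)| <= 2 :> R.
Proof.
have pi0 : 0 < pi :> R := pi_gt0 R.
rewrite -(odd_double_half s); case: (odd s) => /=; set j := s./2.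
  (* Passing to the next even time moves the argument of the root by 2 / pi <= 1, which costs the
     second unit of the bound. *)
  rewrite add1n walk_dist_doubleS; have := walk_dist_double_bound j.+1.
  have -> : 4 * j.+1%:R / pi = 2 * j.*2.+1%:R / pi + 2 / pi :> R.
    by rewrite -[j.+1%:R]natr1 -[j.*2.+1%:R]natr1 -mul2n natrM; ring.
  have p1 : 0 <= 2 * j.*2.+1%:R / pi :> R by rewrite divr_ge0// ltW.
  have p2 : 0 <= 2 / pi :> R by rewrite divr_ge0// ltW.
  have p3 : 2 / pi <= 1 :> R by rewrite ler_pdivrMr// mul1r pi_ge2.
  have /andP[] := sqrtr_add_le1 p1 p2 p3.
  by rewrite !ler_norml => *; apply/andP; split; lra.
rewrite add0n; have := walk_dist_double_bound j.
have -> : 4 * j%:R / pi = 2 * j.*2%:R / pi :> R by rewrite -mul2n natrM; ring.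
by rewrite !ler_norml => *; apply/andP; split; lra.
Qed.

(* [t] is E|K - L| for independent Poisson variables K and L with mean [l]. *)
Lemma pois_mean_abs_diff (l : R) : 0 <= l ->
  exists2 t, psum2 l (fun i j => `|i%:R - j%:R|) @ \oo --> t &
    `|t - 2 * Num.sqrt (l / pi)| <= 4.
Proof.
move=> l0; have pi0 : 0 < pi :> R := pi_gt0 R.
have l20 : 0 <= 2 * l by rewrite mulr_ge0.
(* With u and v the roots at [s] and at the mean 2 l, (u - v) ^ 2 v ^ 2 <= (u ^ 2 - v ^ 2) ^ 2
   bounds (u - v) ^ 2 by (s - 2 l) ^ 2 / (2 l), as pi >= 2. Since |u - v| <= 1 + (u - v) ^ 2, the
   variance of K + L suffices: the total is 2 + 1 + 1 = 4. The quotient is meaningless for [l = 0],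
   where a majorant linear in [s], with mean 3, replaces it. *)
have wb s : `|walk_dist s - 2 * Num.sqrt (l / pi)| <=
    (if l == 0 then 3 + s%:R else 3 + (2 * l)^-1 * (s%:R - 2 * l) ^+ 2) :> R.
  have := walk_dist_bound s; case: ifPn => [/eqP ->|ln0].
    rewrite mul0r sqrtr0 mulr0 subr0 => h.
    have : Num.sqrt (2 * s%:R / pi) <= 1 + s%:R :> R.
      have w1 : 0 <= 1 + s%:R :> R by rewrite addr_ge0.
      rewrite -[leRHS](ger0_norm w1) -sqrtr_sqr ler_wsqrtr//.
      rewrite ler_pdivrMr//; have := pi_ge2 R; have : 0 <= s%:R :> R by [].
      nra.
    move: h; rewrite !ler_norml => /andP[h1 h2] h3; apply/andP; split; last lra.
    have := sqrtr_ge0 (2 * s%:R / pi : R); have : 0 <= s%:R :> R by []; lra.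
  have lgt0 : 0 < l by rewrite lt_neqAle eq_sym ln0.
  set u := Num.sqrt (2 * s%:R / pi); set v := 2 * Num.sqrt (l / pi).
  have u2 : u ^+ 2 = 2 * s%:R / pi by rewrite sqr_sqrtr// divr_ge0// ltW.
  have v2 : v ^+ 2 = 4 * (l / pi).
    by rewrite exprMn sqr_sqrtr ?divr_ge0// 1?ltW//; ring.
  have u0 : 0 <= u by exact: sqrtr_ge0.
  have v0 : 0 <= v by rewrite mulr_ge0 ?sqrtr_ge0.
  have uv2 : (u - v) ^+ 2 <= (2 * l)^-1 * (s%:R - 2 * l) ^+ 2.
    have h1 : (u - v) ^+ 2 * v ^+ 2 <= (u ^+ 2 - v ^+ 2) ^+ 2.
      by rewrite subr_sqr [leRHS]exprMn ler_wpM2l ?sqr_ge0// ler_sqr ?nnegrE ?addr_ge0// lerDr.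
    have v2gt0 : 0 < v ^+ 2 by rewrite v2 mulr_gt0// divr_gt0.
    rewrite -(ler_pM2r v2gt0) (le_trans h1)// u2 v2.
    rewrite (_ : (_ - _) ^+ 2 = (2 / pi) * ((s%:R - 2 * l) ^+ 2 * (2 / pi))); last by ring.
    rewrite [leRHS](_ : _ = 1 * ((s%:R - 2 * l) ^+ 2 * (2 / pi))); last first.
      have : pi != 0 :> R by rewrite gt_eqF.
      by move: (pi : R) => p p0; field; rewrite ln0 p0.
    apply: ler_wpM2r; last by rewrite ler_pdivrMr// mul1r pi_ge2.
    by rewrite mulr_ge0 ?sqr_ge0// divr_ge0// ltW.
  have : `|u - v| <= 1 + (u - v) ^+ 2.
    move: (u - v) => w; have := sqr_ge0 (w + 2^-1); have := sqr_ge0 (w - 2^-1).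
    by rewrite ler_norml => ? ?; apply/andP; split; nra.
  by move=> h1 h2; rewrite -(subrKA u) (le_trans (ler_normD _ _))//; lra.
have [B B4 Blim] : exists2 B : R, B <= 4 & psum (2 * l) (fun s => if l == 0 then 3 + s%:R
    else 3 + (2 * l)^-1 * (s%:R - 2 * l) ^+ 2) @ \oo --> B.
  have [->|ln0] := eqVneq l 0.
    exists (3 + 0); first lra.
    by rewrite mulr0; exact: psumD (@psum_cst _ _ 3) (@psum_mean _ _).
  exists (3 + (2 * l)^-1 * (2 * l)).
    by rewrite mulVf ?mulf_neq0//; lra.
  exact: psumD (@psum_cst _ _ 3) (psumZ (@psum_var _ _)).
have /cvg_ex[t tlim] : cvgn (psum (2 * l) (fun s => walk_dist s - 2 * Num.sqrt (l / pi))).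
  by apply: (psum_dominated l20 wb); apply/cvg_ex; exists B.
exists (t + 2 * Num.sqrt (l / pi)).
  apply: psum2_abs_cvg => //.
  apply: psum_eq (psumD tlim (@psum_cst _ _ (2 * Num.sqrt (l / pi)))) => // s.
  by rewrite subrK.
by rewrite addrK (le_trans _ B4)//; exact: psum_norm_le l20 wb tlim Blim.
Qed.

End wallis.

(** * Taylor bounds on the half-line *)

Section halfline.
Context {R : realType}.
Implicit Types (g dg : R -> R) (x y : R).

Lemma halfline_derivativeP g dg x eps : halfline_derivative g dg -> 0 <= x ->
  0 < eps -> exists2 del, 0 < del & forall y, 0 <= y -> `|y - x| < del ->
    `|g y - g x - dg x * (y - x)| <= eps * `|y - x|.
Proof.
move=> gdg x0 eps0; have /cvgrPdist_le/(_ _ eps0) := gdg x x0.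
rewrite near_withinE => -[del /= del0 H]; exists del => // y y0 yx.
have [->|yneqx] := eqVneq y x; first by rewrite !subrr mulr0 subr0 normr0 mulr0.
have yx0 : y - x != 0 by rewrite subr_eq0.
have := H y; rewrite /= distrC => /(_ yx yneqx); rewrite in_itv/= y0/= => /(_ isT).
rewrite distrC -(ler_pM2r (_ : 0 < `|y - x|)) ?normr_gt0// -normrM.
by rewrite mulrBl divfK.
Qed.

Lemma halfline_is_derive g dg x : halfline_derivative g dg -> 0 < x ->
  is_derive x 1 g (dg x).
Proof.
move=> gdg x0.
suff H : h^-1 *: ((g \o shift x) (h *: 1) - g x) @[h --> 0^'] --> dg x.
  by split; [apply/cvg_ex; exists (dg x)|exact: cvg_lim].
apply/cvgrPdist_le => eps eps0.
have [del del0 H] := halfline_derivativeP gdg (ltW x0) eps0.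
near=> h.
have h0 : h != 0 by near: h; exact: nbhs_dnbhs_neq.
have hd : `|h| < Num.min del x.
  near: h; apply: dnbhs0_lt; by rewrite lt_min del0.
have {hd} [hd hx] : `|h| < del /\ `|h| < x by apply/andP; rewrite -lt_min.
have hx0 : 0 <= h + x by move: hx; rewrite ltr_norml => /andP[]; lra.
have := H _ hx0; rewrite addrK => /(_ hd).
rewrite /shift /= -[h *: 1]/(h * 1) mulr1 -[_ *: _]/(h^-1 * _) => H1.
rewrite -(ler_pM2r (_ : 0 < `|h|)) ?normr_gt0// distrC -normrM.
by rewrite mulrBl mulrAC mulVf// mul1r.
Unshelve. all: by end_near. Qed.

(** The intermediate points produced by [MVT] are interior, so two-sided derivatives at positive
    points suffice and the endpoint 0 is covered by continuity. Saying that [c] is no farther from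
    [x] than [y] treats both orders of [x] and [y] at once. *)
Lemma halfline_mvt g dg x y : {within `[0, +oo[, continuous g} ->
    (forall c : R, 0 < c -> is_derive c 1 g (dg c)) -> 0 <= x -> 0 <= y ->
  exists c, [/\ 0 <= c, `|c - x| <= `|y - x| & g y - g x = dg c * (y - x)].
Proof.
move=> cg gdg.
have mvt a b : 0 <= a -> a < b ->
    exists c, [/\ a <= c, c <= b & g b - g a = dg c * (b - a)].
  move=> a0 ab; have [|c|c] := @MVT _ g dg a b ab.
  - by move=> c; rewrite in_itv/= => /andP[ac _]; apply: gdg; exact: le_lt_trans ac.
  - apply: (continuous_subspaceW _ cg) => z /=; rewrite !in_itv/= andbT => /andP[az _].
    exact: le_trans az.
  - by rewrite in_itv/= => /andP[/ltW ac /ltW cb] e; exists c.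
move=> x0 y0; have [xy|yx|<-] := ltgtP x y.
- have [c [ac cb e]] := mvt _ _ x0 xy; exists c; split => //; first lra.
  by rewrite !ger0_norm; lra.
- have [c [ac cb e]] := mvt _ _ y0 yx; exists c; split => //; first lra.
    by rewrite !ler0_norm; lra.
  by rewrite -opprB e; ring.
- by exists x; rewrite !subrr mulr0.
Qed.

Lemma halfline_bounded g : halfline_cont_bounded g ->
  exists2 M, 0 <= M & forall x, 0 <= x -> `|g x| <= M.
Proof.
move=> [_ [M [Mr HM]]]; exists (`|M| + 1); first by rewrite addr_ge0.
move=> x x0; apply: (HM (`|M| + 1)); last by rewrite /= in_itv/= x0.
by rewrite (le_lt_trans (ler_norm _))// ltrDl.
Qed.

Lemma lipschitz_halfline g dg M : {within `[0, +oo[, continuous g} ->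
  halfline_derivative g dg -> (forall x, 0 <= x -> `|dg x| <= M) ->
  forall x y, 0 <= x -> 0 <= y -> `|g y - g x| <= M * `|y - x|.
Proof.
move=> cg gdg dM x y x0 y0; have dg' := fun c => @halfline_is_derive _ _ c gdg.
have [c [c0 _ ->]] := halfline_mvt cg dg' x0 y0.
by rewrite normrM ler_wpM2r ?dM.
Qed.

Section second_order.
Variables (g dg d2g : R -> R) (M : R).
Hypotheses (cg : {within `[0, +oo[, continuous g})
  (cdg : {within `[0, +oo[, continuous dg})
  (gdg : halfline_derivative g dg) (dgd2g : halfline_derivative dg d2g)
  (d2M : forall x, 0 <= x -> `|d2g x| <= M).

(** The mean value theorem followed by the Lipschitz bound on [dg]; this yields the constant [M],
    without the factor 1/2 of the sharp form. *)
Lemma taylor1_halfline x y : 0 <= x -> 0 <= y ->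
  `|g y - g x - dg x * (y - x)| <= M * (y - x) ^+ 2.
Proof.
move=> x0 y0; have dg' := fun c => @halfline_is_derive _ _ c gdg.
have [c [c0 cx ->]] := halfline_mvt cg dg' x0 y0.
rewrite -mulrBl normrM -real_normK ?num_real// expr2 mulrA ler_wpM2r//.
have := lipschitz_halfline cdg dgd2g d2M x0 c0.
move/le_trans; apply; apply: ler_wpM2l => //.
exact: le_trans (normr_ge0 _) (d2M x0).
Qed.

(** Near [x] the remainder is small by differentiability of [dg] at [x]. At distance [del] or more,
    a quadratic bound with constant 2 M is traded for a quartic one through 1 <= (y - x) ^ 2 / del ^
    2. The quartic term is harmless later, because the fourth central moment of K / m is O(m ^
    -2). *)
Lemma taylor2_halfline x eps : 0 <= x -> 0 < eps ->
  exists2 K, 0 <= K & forall y, 0 <= y ->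
    `|g y - g x - dg x * (y - x) - d2g x / 2 * (y - x) ^+ 2| <=
      eps * (y - x) ^+ 2 + K * (y - x) ^+ 4.
Proof.
move=> x0 eps0; have [del del0 H] := halfline_derivativeP dgd2g x0 eps0.
have M0 : 0 <= M by exact: le_trans (normr_ge0 _) (d2M x0).
have K0 : 0 <= 2 * M / del ^+ 2 by apply: divr_ge0; [rewrite mulr_ge0|exact: sqr_ge0].
exists (2 * M / del ^+ 2) => //.
move=> y y0; have sq0 := sqr_ge0 (y - x).
have q0 : 0 <= (y - x) ^+ 4 by rewrite exprn_even_ge0.
have [yd|yd] := ltP `|y - x| del.
  (* The increment of [h] from [x] to [y] is the remainder, and its derivative is the first-order
     remainder of [dg], which [H] controls. *)
  pose h z := g z - dg x * (z - x) - d2g x / 2 * (z - x) ^+ 2.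
  have hE : h = g - dg x *: (id - cst x) - (d2g x / 2) *: (id - cst x) ^+ 2.
    by apply/funext => z; rewrite /h !fctE.
  have dh (c : R) : 0 < c -> is_derive c 1 h (dg c - dg x - d2g x * (c - x)).
    move=> c0; have gc := halfline_is_derive gdg c0.
    have i1 : is_derive c (1 : R) (id - cst x : R -> R) (1 - 0) by apply: is_deriveB.
    have i2 := is_deriveX 2 i1.
    have := is_deriveB (is_deriveB gc (is_deriveZ (dg x) i1)) (is_deriveZ (d2g x / 2) i2).
    rewrite -hE (_ : _ - _ = dg c - dg x - d2g x * (c - x))//.
    by rewrite /GRing.scale/= !fctE; field.
  have ch : {within `[0, +oo[, continuous h}.
    pose p : R -> R := dg x *: (id - cst x) + (d2g x / 2) *: (id - cst x) ^+ 2.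
    have cp : {within `[0, +oo[, continuous p}.
      apply: continuous_subspaceT => z.
      have i1 : is_derive z (1 : R) (id - cst x : R -> R) (1 - 0) by apply: is_deriveB.
      have i2 := is_deriveX 2 i1.
      exact: is_derive_continuous
        (is_deriveD (is_deriveZ (dg x) i1) (is_deriveZ (d2g x / 2) i2)).
    rewrite hE -addrA -opprD -/p => z.
    by apply: cvgB; [exact: cg|exact: cp].
  have [c [c0 cx e]] := halfline_mvt ch dh x0 y0.
  rewrite (_ : _ - _ = h y - h x); last by rewrite /h; ring.
  rewrite e normrM; have := H c c0 (le_lt_trans cx yd) => H1.
  have H2 : `|dg c - dg x - d2g x * (c - x)| <= eps * `|y - x|.
    by apply: le_trans H1 _; rewrite ler_wpM2l// ltW.
  rewrite (@le_trans _ _ (eps * `|y - x| * `|y - x|)) ?ler_wpM2r//.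
  rewrite -mulrA -expr2 real_normK ?num_real// lerDl mulr_ge0//.
have h1 := taylor1_halfline x0 y0.
have h2 := d2M x0.
have h3 : 2 * M * (y - x) ^+ 2 <= 2 * M / del ^+ 2 * (y - x) ^+ 4.
  rewrite (_ : (y - x) ^+ 4 = (y - x) ^+ 2 * (y - x) ^+ 2); last ring.
  rewrite mulrA ler_wpM2r// -[leRHS]mulrA -[leLHS]mulr1 ler_wpM2l ?mulr_ge0//.
  rewrite mulrC ler_pdivlMr ?exprn_gt0// mul1r.
  by rewrite -[leRHS]real_normK ?num_real//; apply: lerXn2r; rewrite ?nnegrE ?(ltW del0) ?normr_ge0.
have h4 : `|d2g x / 2 * (y - x) ^+ 2| <= M * (y - x) ^+ 2.
  rewrite normrM (ger0_norm sq0) ler_wpM2r// normrM (@ger0_norm _ 2^-1)//; lra.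
rewrite (le_trans (ler_normB _ _))//; have := mulr_ge0 (ltW eps0) sq0; lra.
Qed.

End second_order.
End halfline.

(** * Least sample sizes *)

Lemma nat_min_spec (S : set nat) k : S k ->
  S (nat_min S) /\ forall j, S j -> (nat_min S <= j)%N.
Proof.
move=> Sk; have [k0 [Sk0 k0min]] : exists k0, S k0 /\ forall j, S j -> (k0 <= j)%N.
  have ex : exists k, `[< S k >] by exists k; apply/asboolP.
  have := ex_minnP ex => -[k0 /asboolP Sk0 H]; exists k0; split => // j Sj.
  exact/H/asboolP.
have : (S `&` lbound S) (nat_min S).
  apply: xgetPex; exists k0; split => // j Sj.
by move=> [? lb]; split => // j /lb.
Qed.

Section deficiency_asymptotics.
Context {R : realType}.

Lemma near_cvgn (g h : nat -> R) (l : R) : g @ \oo --> l ->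
  (\forall n \near \oo, g n = h n) -> h @ \oo --> l.
Proof. by move=> gl gh; apply: cvg_trans gl; exact: near_eq_cvg. Qed.

Lemma cvgnB (g h : nat -> R) (l k : R) : g @ \oo --> l -> h @ \oo --> k ->
  g n - h n @[n --> \oo] --> l - k.
Proof. exact: cvgB. Qed.

Lemma cvgnD (g h : nat -> R) (l k : R) : g @ \oo --> l -> h @ \oo --> k ->
  g n + h n @[n --> \oo] --> l + k.
Proof. exact: cvgD. Qed.

Lemma cvgnM (g h : nat -> R) (l k : R) : g @ \oo --> l -> h @ \oo --> k ->
  g n * h n @[n --> \oo] --> l * k.
Proof. exact: cvgM. Qed.

(** For [0 < k] the condition reads s / M <= k, so the minimum is the ceiling of s / M. *)
Lemma nat_min_ratio (s M : R) : 0 < s -> 0 < M ->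
  `|(nat_min [set k | (0 < k)%N /\ s / k%:R <= M])%:R - s / M| <= 1.
Proof.
move=> s0 M0; have sM0 : 0 < s / M by rewrite divr_gt0.
set S := [set k | _].
have SE k : (0 < k)%N -> (s / k%:R <= M) = (s / M <= k%:R).
  by move=> k0; rewrite ler_pdivrMr ?ltr0n// ler_pdivrMr// mulrC.
have [|[u0 uM] ulb] := @nat_min_spec S (Num.truncn (s / M)).+1.
  by split => //; rewrite SE// ltW// truncnS_gt.
set u := nat_min S in u0 uM ulb *.
rewrite SE// in uM.
rewrite ger0_norm ?subr_ge0// lerBlDr.
(* If the minimum is 1, its predecessor is excluded by [0 < k] and the bound follows from 0 < s / M;
   otherwise the predecessor is positive and violates the condition. *)
case: u u0 uM ulb => // -[_ _ _|v _ _ ulb].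
  by rewrite lerDl ltW.
rewrite -natr1 addrC lerD2l leNgt; apply/negP => /ltW vM.
have : S v.+1 by split => //; rewrite SE.
by move/ulb; rewrite ltnn.
Qed.

Lemma powRN_cvg0 (t : nat -> R) (p : R) : 0 < p -> t @ \oo --> +oo ->
  t n `^ (- p) @[n --> \oo] --> 0.
Proof.
move=> p0 /cvgryPge toy; apply/cvgrPdist_le => e e0.
near=> n.
have tn : e `^ (- p^-1) <= t n by near: n; exact: toy.
have e10 : 0 < e `^ (- p^-1) by exact: powR_gt0.
rewrite sub0r normrN ger0_norm ?powR_ge0//.
have tn0 : 0 < t n := lt_le_trans e10 tn.
rewrite powRN -[e]invrK lef_pV2 ?posrE ?powR_gt0 ?invr_gt0//.
have -> : e^-1 = (e `^ (- p^-1)) `^ p.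
  by rewrite -powRrM mulNr mulVf ?gt_eqF// powRN powRr1// ltW.
by rewrite ge0_ler_powR// ?nnegrE ?ltW.
Unshelve. all: by end_near. Qed.

Lemma powR_cvg (t : nat -> R) (p c : R) : 0 < c -> t @ \oo --> c ->
  t n `^ p @[n --> \oo] --> c `^ p.
Proof.
move=> c0 tc.
suff h : {for c, continuous (fun x : R => x `^ p)} by exact: (cvg_comp _ _ tc h).
apply: differentiable_continuous; apply/derivable1_diffP.
by apply: derivable_powR; rewrite in_itv/= c0.
Qed.

Variables (s V b : R) (m : nat -> nat) (A B : nat -> R) (u : nat -> nat).
Hypotheses (s_gt0 : 0 < s) (m_gt0 : forall n, (0 < m n)%N) (m_oo : m @ \oo --> \oo)
  (A_lim : Num.sqrt (m n)%:R * (s - A n) @[n --> \oo] --> V)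
  (B_lim : (m n)%:R ^+ 2 * B n @[n --> \oo] --> b)
  (u_ratio : forall n, 0 < A n / n%:R + B n ->
     `|(u n)%:R - s / (A n / n%:R + B n)| <= 1).

Let mr_gt0 n : 0 < (m n)%:R :> R. Proof. by rewrite ltr0n. Qed.

Let mr_oo : ((m n)%:R : R) @[n --> \oo] --> +oo.
Proof. exact/cvgrnyP. Qed.

Lemma natr_oo : (n%:R : R) @[n --> \oo] --> +oo.
Proof. exact/cvgrnyP/cvg_id. Qed.

Lemma A_cvg : A @ \oo --> s.
Proof.
have h : (m n)%:R `^ (- 2^-1) * (Num.sqrt (m n)%:R * (s - A n)) @[n --> \oo] --> 0 * V.
  by apply: cvgM A_lim; apply: powRN_cvg0.
rewrite mul0r in h.
rewrite -[s]subr0; apply: (near_cvgn (cvgnB (cvg_cst s) h)).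
near=> n.
rewrite powRN powR12_sqrt// mulrA mulVf ?mul1r ?opprB ?subrKC//.
by rewrite gt_eqF// sqrtr_gt0.
Unshelve. all: by end_near. Qed.

(* The sample size is measured at an arbitrary rate [n / q n]; the three regimes
   of the theorem correspond to [q n = 1], [m n ^ (1/2)] and [n ^ (1/3)]. *)
Lemma deficiency_rate (q : nat -> R) (V' b' : R) :
  (\forall n \near \oo, 0 < q n) ->
  n%:R / (m n)%:R ^+ 2 @[n --> \oo] --> (0 : R) ->
  q n * (s - A n) @[n --> \oo] --> V' ->
  q n * n%:R * B n @[n --> \oo] --> b' ->
  q n / n%:R @[n --> \oo] --> 0 ->
  equals_scaled_o1 (fun n => (u n)%:R - n%:R) (fun n => n%:R / q n) ((V' - b') / s).
Proof.
move=> q0 nm0 qV qb qn0.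
pose M n := A n / n%:R + B n.
(* [D n] is n times [M n], so s / M - n = n (s - D) / D. Multiplied by q / n this is (q (s - A) - q
   n B) / D, which tends to (V' - b') / s; the rounding error contributes at most q / n. *)
pose D n := A n + n%:R * B n.
have Ds : D @ \oo --> s.
  rewrite -[s]addr0; apply: cvgD; first exact: A_cvg.
  have h := cvgnM nm0 B_lim; rewrite mul0r in h.
  apply: near_cvgn h _; near=> n.
  by rewrite mulrA divfK// expf_neq0// gt_eqF.
have D0 : \forall n \near \oo, 0 < D n.
  exact: (cvgr_gt _ Ds).
exists (fun n => ((u n)%:R - n%:R) * (q n / n%:R) - (V' - b') / s); last first.
  near=> n.
  have n0 : 0 < n%:R :> R by rewrite ltr0n; near: n; exact: nbhs_infty_gt.
  have qn : 0 < q n by near: n.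
  by rewrite subrKC; field; rewrite !gt_eqF.
rewrite -[X in _ --> X](subrr ((V' - b') / s)).
apply: cvgB; last exact: cvg_cst.
have l1 : (q n * (s - A n) - q n * n%:R * B n) / D n @[n --> \oo] --> (V' - b') / s.
  by apply: cvgM; [exact: cvgB|apply: cvgV => //; rewrite gt_eqF].
rewrite -[X in _ --> X]addr0.
have l2 : ((u n)%:R - s / M n) * (q n / n%:R) @[n --> \oo] --> 0.
  apply/norm_cvg0P; apply: (@squeeze_cvgr _ _ _ _ (fun=> 0) (fun n => q n / n%:R)) => //;
    last exact: cvg_cst.
  near=> n.
  have n0 : 0 < n%:R :> R by rewrite ltr0n; near: n; exact: nbhs_infty_gt.
  have qn : 0 < q n by near: n.
  have Dn : 0 < D n by near: n.
  have Mn : 0 < M n.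
    by rewrite (_ : M n = D n / n%:R) ?divr_gt0// /M /D; field; rewrite gt_eqF.
  have qn' : 0 <= q n / n%:R by rewrite ltW// divr_gt0.
  by rewrite normr_ge0/= normrM (ger0_norm qn') ler_piMl ?u_ratio.
apply: (near_cvgn (cvgnD l1 l2)); near=> n.
have n0 : 0 < n%:R :> R by rewrite ltr0n; near: n; exact: nbhs_infty_gt.
have Dn : 0 < D n by near: n.
have -> : M n = D n / n%:R by rewrite /M /D; field; rewrite gt_eqF.
move: Dn; rewrite /D => Dn.
by field; rewrite !gt_eqF.
Unshelve. all: by end_near. Qed.

(** The rate [q = 1]: the hypothesis amounts to n / m ^ 2 -> 0, which kills n B, and s - A tends to
    0 as well, so the second-order coefficient is 0. *)
Lemma deficiency_first_order :
  ((m n)%:R * n%:R `^ (- (1 / 2)) : R) @[n --> \oo] --> +oo ->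
  equals_scaled_o1 (fun n => (u n)%:R) (fun n => n%:R) (1 : R).
Proof.
move=> mn.
have nm0 : n%:R / (m n)%:R ^+ 2 @[n --> \oo] --> (0 : R).
  have h := powRN_cvg0 (ltr0n R 2) mn.
  apply: near_cvgn h _; near=> n.
  rewrite powRM ?powR_ge0// -powRrM powRN powR_mulrn// mulrNN div1r mulVf// powRr1//.
  by rewrite mulrC.
have V0 : 1 * (s - A n) @[n --> \oo] --> 1 * (s - s).
  by apply: cvgM; [exact: cvg_cst|apply: cvgB; [exact: cvg_cst|exact: A_cvg]].
have b0 : 1 * n%:R * B n @[n --> \oo] --> 0 * b.
  apply: (near_cvgn (cvgnM nm0 B_lim)); near=> n.
  by rewrite mul1r mulrA divfK// expf_neq0// gt_eqF.
have n0 : 1 / n%:R @[n --> \oo] --> (0 : R).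
  apply: (near_cvgn (powRN_cvg0 ltr01 natr_oo)); near=> n.
  by rewrite powRN powRr1// div1r.
have [|e e0 ue] := deficiency_rate _ nm0 V0 b0 n0; first exact: nearW.
exists e => //; near=> n.
rewrite -[LHS](subrK n%:R).
have -> : (u n)%:R - n%:R = n%:R / 1 * ((1 * (s - s) - 0 * b) / s + e n).
  by near: n.
by rewrite subrr mulr0 mul0r subr0 mul0r divr1 add0r; ring.
Unshelve. all: by end_near. Qed.

(** The rate [q] = m ^ (1 / 2). The bias disappears because q n B = (n m ^ (-3/2)) (m ^ 2 B), where
    the first factor is a negative power of m n ^ (-2/3); the rounding error q / n is the root of m
    n ^ -2. *)
Lemma deficiency_rate_variance :
  ((m n)%:R * n%:R `^ (- (2 / 3)) : R) @[n --> \oo] --> +oo ->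
  ((m n)%:R * n%:R `^ (- 2) : R) @[n --> \oo] --> 0 ->
  equals_scaled_o1 (fun n => (u n)%:R - n%:R)
    (fun n => (m n)%:R `^ (- (1 / 2)) * n%:R) (V / s).
Proof.
move=> mn mn2.
have t0 : n%:R * (m n)%:R `^ (- (3 / 2)) @[n --> \oo] --> (0 : R).
  have p0 : 0 < 3 / 2 :> R by [].
  apply: (near_cvgn (powRN_cvg0 p0 mn)); near=> n.
  rewrite powRM ?powR_ge0// -powRrM (_ : - (2 / 3) * - (3 / 2) = 1); last by field.
  by rewrite powRr1// mulrC.
have q0 : \forall n \near \oo, 0 < (m n)%:R `^ 2^-1 :> R.
  by near=> n; rewrite powR_gt0.
have nm0 : n%:R / (m n)%:R ^+ 2 @[n --> \oo] --> (0 : R).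
  have p2 : 0 < 2^-1 :> R by [].
  have h := cvgnM t0 (powRN_cvg0 p2 mr_oo).
  rewrite mul0r in h; apply: near_cvgn h _; near=> n.
  rewrite -mulrA -powRD; last by rewrite (gt_eqF (mr_gt0 _)) implybT.
  by rewrite (_ : - (3 / 2) - 2^-1 = - 2); [rewrite powRN powR_mulrn|field].
have qV : (m n)%:R `^ 2^-1 * (s - A n) @[n --> \oo] --> V.
  by under eq_fun do rewrite powR12_sqrt//.
have qb : (m n)%:R `^ 2^-1 * n%:R * B n @[n --> \oo] --> 0 * b.
  apply: (near_cvgn (cvgnM t0 B_lim)); near=> n.
  rewrite mulrA; congr (_ * _); rewrite -powR_mulrn// -mulrA -powRD; last first.
    by rewrite (gt_eqF (mr_gt0 _)) implybT.
  by rewrite (_ : - (3 / 2) + 2 = 2^-1); [rewrite mulrC|field].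
have qn0 : (m n)%:R `^ 2^-1 / n%:R @[n --> \oo] --> (0 : R).
  have h : Num.sqrt ((m n)%:R * n%:R `^ (- 2)) @[n --> \oo] --> Num.sqrt (0 : R).
    exact: cvg_comp mn2 (@sqrt_continuous R 0).
  rewrite sqrtr0 in h.
  apply: near_cvgn h _; near=> n.
  by rewrite powRN powR_mulrn// sqrtrM// sqrtrV ?exprn_ge0// sqrtr_sqr ger0_norm// powR12_sqrt.
have [e e0 ue] := deficiency_rate q0 nm0 qV qb qn0.
exists e => //; near=> n.
have -> : (u n)%:R - n%:R = n%:R / (m n)%:R `^ 2^-1 * ((V - 0 * b) / s + e n).
  by near: n.
by rewrite mul0r subr0 div1r powRN [n%:R / _]mulrC.
Unshelve. all: by end_near. Qed.

(** The rate [q] = n ^ (1 / 3). With t = m n ^ (-2/3) tending to c, q = t ^ (-1/2) m ^ (1/2) and q n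
    / m ^ 2 = t ^ -2, whence the two powers of c. *)
Lemma deficiency_rate_balanced (c : R) : 0 < c ->
  ((m n)%:R * n%:R `^ (- (2 / 3)) : R) @[n --> \oo] --> c ->
  equals_scaled_o1 (fun n => (u n)%:R - n%:R) (fun n => n%:R `^ (2 / 3))
    (c `^ (- (1 / 2)) * (V / s) - c `^ (- 2) * (b / s)).
Proof.
move=> c0 mn.
have q0 : \forall n \near \oo, 0 < n%:R `^ 3^-1 :> R.
  by near=> n; rewrite powR_gt0// ltr0n; near: n; exact: nbhs_infty_gt.
have tE p : \forall n \near \oo, ((m n)%:R * n%:R `^ (- (2 / 3))) `^ p =
    (m n)%:R `^ p * n%:R `^ (- (2 / 3) * p) :> R.
  by near=> n; rewrite powRM ?powR_ge0// -powRrM.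
have qb0 : n%:R `^ 3^-1 * n%:R / (m n)%:R ^+ 2 @[n --> \oo] --> c `^ (- 2).
  apply: (near_cvgn (@powR_cvg _ (- 2) _ c0 mn)); near=> n.
  have n0 : 0 < n%:R :> R by rewrite ltr0n; near: n; exact: nbhs_infty_gt.
  rewrite (near (tE (- 2)) n)// powRN powR_mulrn// mulrC; congr (_ / _).
  rewrite (_ : - (2 / 3) * - 2 = 3^-1 + 1); last by field.
  by rewrite powRD ?powRr1// (gt_eqF n0) implybT.
have p3 : 0 < 3^-1 :> R by [].
have p23 : 0 < 2 / 3 :> R by [].
have nm0 : n%:R / (m n)%:R ^+ 2 @[n --> \oo] --> (0 : R).
  have h := cvgnM (powRN_cvg0 p3 natr_oo) qb0; rewrite mul0r in h.
  apply: near_cvgn h _; near=> n.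
  have qn : 0 < n%:R `^ 3^-1 :> R by near: n.
  by rewrite powRN -!mulrA mulKf ?gt_eqF.
have qV : n%:R `^ 3^-1 * (s - A n) @[n --> \oo] --> c `^ (- (1 / 2)) * V.
  apply: (near_cvgn (cvgnM (@powR_cvg _ (- (1 / 2)) _ c0 mn) A_lim)).
  near=> n.
  rewrite (near (tE (- (1 / 2))) n)// (_ : _ * - (1 / 2) = 3^-1); last by field.
  rewrite powRN div1r powR12_sqrt// mulrAC !mulrA mulVf ?mul1r 1?mulrC//.
  by rewrite gt_eqF// sqrtr_gt0.
have qb : n%:R `^ 3^-1 * n%:R * B n @[n --> \oo] --> c `^ (- 2) * b.
  apply: (near_cvgn (cvgnM qb0 B_lim)); near=> n.
  by rewrite mulrA divfK// expf_neq0// gt_eqF.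
have qn0 : n%:R `^ 3^-1 / n%:R @[n --> \oo] --> (0 : R).
  apply: (near_cvgn (powRN_cvg0 p23 natr_oo)); near=> n.
  have n0 : 0 < n%:R :> R by rewrite ltr0n; near: n; exact: nbhs_infty_gt.
  rewrite (_ : n%:R^-1 = n%:R `^ (- 1)); last by rewrite powRN powRr1// ltW.
  rewrite -powRD; last by rewrite (gt_eqF n0) implybT.
  by congr (_ `^ _); field.
have [e e0 ue] := deficiency_rate q0 nm0 qV qb qn0.
exists e => //; near=> n.
have n0 : 0 < n%:R :> R by rewrite ltr0n; near: n; exact: nbhs_infty_gt.
have -> : (u n)%:R - n%:R = n%:R / n%:R `^ 3^-1 *
    ((c `^ (- (1 / 2)) * V - c `^ (- 2) * b) / s + e n) by near: n.
congr (_ * _); last by rewrite mulrBl !mulrA.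
rewrite -{1}(powRr1 (ltW n0)) -powRN -powRD; last by rewrite (gt_eqF n0) implybT.
by congr (_ `^ _); field.
Unshelve. all: by end_near. Qed.

End deficiency_asymptotics.

(** * Poisson smoothing *)

Section poisson_smoothing.
Context {R : realType}.

Lemma psum2_prod (l : R) (g h : nat -> R) N :
  psum2 l (fun i j => g i * h j) N = psum l g N * psum l h N.
Proof.
rewrite /psum2 /psum mulr_suml; apply: eq_bigr => i _.
by rewrite mulr_sumr; apply: eq_bigr => j _; rewrite mulrACA.
Qed.

Lemma psum2D (l : R) (g h : nat -> nat -> R) N :
  psum2 l (fun i j => g i j + h i j) N = psum2 l g N + psum2 l h N.
Proof.
rewrite /psum2 -big_split/=; apply: eq_bigr => i _.
by rewrite -big_split/=; apply: eq_bigr => j _; rewrite mulrDl.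
Qed.

Lemma psum2Z (l : R) (g : nat -> nat -> R) c N :
  psum2 l (fun i j => c * g i j) N = c * psum2 l g N.
Proof.
rewrite /psum2 mulr_sumr; apply: eq_bigr => i _.
by rewrite mulr_sumr; apply: eq_bigr => j _; rewrite -!mulrA.
Qed.

Lemma psum2_norm_le (l : R) (g h : nat -> nat -> R) N : 0 <= l ->
  (forall i j, `|g i j| <= h i j) -> `|psum2 l g N| <= psum2 l h N.
Proof.
move=> l0 gh; apply: le_trans (ler_norm_sum _ _ _) _; apply: ler_sum => i _.
apply: le_trans (ler_norm_sum _ _ _) _; apply: ler_sum => j _.
have p0 : 0 <= pois l i * pois l j by apply: mulr_ge0; exact: pois_ge0.
by rewrite normrM (ger0_norm p0) ler_wpM2r.
Qed.

Lemma psum_dilated_dev (m : nat) (x : R) : (0 < m)%N ->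
  psum (m%:R * x) (fun k => k%:R / m%:R - x) @ \oo --> (0 : R).
Proof.
move=> m0; have m0' : m%:R != 0 :> R by rewrite pnatr_eq0 -lt0n.
apply: psum_eq (psumD (psumZ (c := m%:R^-1) (@psum_mean _ _)) (@psum_cst _ _ (- x))) => [k|].
  by rewrite mulrC.
by rewrite mulKf// subrr.
Qed.

Lemma psum_dilated_var (m : nat) (x : R) : (0 < m)%N ->
  psum (m%:R * x) (fun k => (k%:R / m%:R - x) ^+ 2) @ \oo --> x / m%:R.
Proof.
move=> m0; have m0' : m%:R != 0 :> R by rewrite pnatr_eq0 -lt0n.
apply: psum_eq (psumZ (c := m%:R ^- 2) (@psum_var _ _)) => [k|]; by field.
Qed.

Lemma psum_dilated_moment4 (m : nat) (x : R) : (0 < m)%N ->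
  psum (m%:R * x) (fun k => (k%:R / m%:R - x) ^+ 4) @ \oo -->
  3 * x ^+ 2 / m%:R ^+ 2 + x / m%:R ^+ 3.
Proof.
move=> m0; have m0' : m%:R != 0 :> R by rewrite pnatr_eq0 -lt0n.
apply: psum_eq (psumZ (c := m%:R ^- 4) (@psum_moment4 _ _)) => [k|]; by field.
Qed.

Variables (g dg d2g : R -> R) (M : R).
Hypotheses (cg : {within `[0, +oo[, continuous g})
  (cdg : {within `[0, +oo[, continuous dg})
  (gdg : halfline_derivative g dg) (dgd2g : halfline_derivative dg d2g)
  (d2M : forall x, 0 <= x -> `|d2g x| <= M).

Let M_ge0 : 0 <= M. Proof. exact: le_trans (normr_ge0 _) (d2M (lexx 0)). Qed.

Let node_ge0 (m k : nat) : 0 <= k%:R / m%:R :> R. Proof. by rewrite divr_ge0. Qed.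

(** The linear Taylor term has mean zero and the quadratic one brings in the variance x / m. *)
Lemma smoothing_bias_bound (m : nat) (x s : R) : (0 < m)%N -> 0 <= x ->
  psum (m%:R * x) (fun k => g (k%:R / m%:R)) @ \oo --> s ->
  `|s - g x| <= M * x / m%:R.
Proof.
move=> m0 x0 sl; have mx0 : 0 <= m%:R * x by rewrite mulr_ge0.
have h1 : psum (m%:R * x)
    (fun k => g (k%:R / m%:R) - g x - dg x * (k%:R / m%:R - x)) @ \oo --> s - g x.
  apply: psum_eq (psumD (psumD sl (@psum_cst _ _ (- g x)))
    (psumZ (c := - dg x) (psum_dilated_dev x m0))) => [k|]; last by rewrite mulr0 addr0.
  by rewrite mulNr.
have h2 := psumZ (c := M) (psum_dilated_var (x := x) m0).
rewrite -mulrA; apply: (psum_norm_le mx0 _ h1 h2) => k.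
exact: taylor1_halfline cg cdg gdg dgd2g d2M _ _ x0 (node_ge0 _ _).
Qed.

Lemma smoothing_bias_limit (m : nat -> nat) (x : R) (s : nat -> R) :
  (forall n, (0 < m n)%N) -> m @ \oo --> \oo -> 0 <= x ->
  (forall n, psum ((m n)%:R * x) (fun k => g (k%:R / (m n)%:R)) @ \oo --> s n) ->
  (m n)%:R * (s n - g x) @[n --> \oo] --> bS d2g x.
Proof.
move=> m0 moo x0 sl; apply/cvgrPdist_le => e e0.
have x10 : 0 < x + 1 by rewrite ltr_wpDl.
(* After multiplication by m the variance x / m leaves a factor x, which division by x + 1 absorbs,
   also for x = 0. *)
have e20 : 0 < e / 2 / (x + 1) by rewrite !divr_gt0.
have [K K0 HK] := taylor2_halfline cg cdg gdg dgd2g d2M x0 e20.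
have key n : `|(m n)%:R * (s n - g x) - bS d2g x| <=
    e / 2 + K * (3 * x ^+ 2 + x) / (m n)%:R.
  have mx0 : 0 <= (m n)%:R * x by rewrite mulr_ge0.
  have mn0 : 0 < (m n)%:R :> R by rewrite ltr0n.
  have mn1 : 1 <= (m n)%:R :> R by rewrite ler1n.
  have h1 := psumD (psumD (psumD (sl n) (@psum_cst _ _ (- g x)))
    (psumZ (c := - dg x) (psum_dilated_dev x (m0 n))))
    (psumZ (c := - (d2g x / 2)) (psum_dilated_var (x := x) (m0 n))).
  have h2 := psumD (psumZ (c := e / 2 / (x + 1)) (psum_dilated_var (x := x) (m0 n)))
    (psumZ (c := K) (psum_dilated_moment4 (x := x) (m0 n))).
  have /= := psum_norm_le mx0 _ h1 h2.
  have -> : s n - g x + - dg x * 0 + - (d2g x / 2) * (x / (m n)%:R) =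
     ((m n)%:R * (s n - g x) - bS d2g x) / (m n)%:R.
    by rewrite /bS; field; rewrite gt_eqF.
  rewrite normrM normfV (gtr0_norm mn0) ler_pdivrMr// => /(_ _)/le_trans -> //.
    by move=> k; rewrite mulNr [- (_ / _) * _]mulNr; exact/HK.
  rewrite [leLHS](_ : _ = e / 2 * (x / (x + 1)) +
     K * (3 * x ^+ 2 + x / (m n)%:R) / (m n)%:R); last first.
    by field; rewrite !gt_eqF.
  rewrite lerD//.
    apply: ler_piMr; first by rewrite divr_ge0// ltW.
    by rewrite ler_pdivrMr// mul1r lerDl.
  rewrite ler_wpM2r ?invr_ge0 ?(ltW mn0)// ler_wpM2l// lerD2l.
  by rewrite ler_pdivrMr// ler_peMr.
have : K * (3 * x ^+ 2 + x) / (m n)%:R @[n --> \oo] --> K * (3 * x ^+ 2 + x) * 0.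
  apply: cvgM; first exact: cvg_cst.
  have mr : ((m n)%:R : R) @[n --> \oo] --> +oo by exact/cvgrnyP.
  apply: near_cvgn (powRN_cvg0 ltr01 mr) _; near=> n.
  by rewrite powRN powRr1.
rewrite mulr0 => /cvgrPdist_le/(_ (e / 2)) => /(_ _)/wrap[]; first by rewrite divr_gt0.
move=> H; near=> n.
have : `|0 - K * (3 * x ^+ 2 + x) / (m n)%:R| <= e / 2 by near: n.
rewrite sub0r normrN => /ler_normlW h.
rewrite distrC (le_trans (key n))//; lra.
Unshelve. all: by end_near. Qed.

(** Since min(K, L) = (K + L - |K - L|) / 2, the linear Taylor term at min(K, L) / m has mean -dg x
    E|K - L| / (2 m). The error 4 in E|K - L| becomes 2 |dg x| / sqrt m, and the quadratic remainder
    becomes 2 M x / sqrt m. *)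
Lemma smoothing_second_moment (m : nat) (x s : R) : (0 < m)%N -> 0 <= x ->
  psum2 (m%:R * x) (fun i j => g ((minn i j)%:R / m%:R)) @ \oo --> s ->
  `|Num.sqrt m%:R * (g x - s) - VS dg x| <=
    (2 * M * x + 2 * `|dg x|) / Num.sqrt m%:R.
Proof.
move=> m0 x0 sl; have mx0 : 0 <= m%:R * x by rewrite mulr_ge0.
have mr0 : 0 < m%:R :> R by rewrite ltr0n.
have [t tl tb] := pois_mean_abs_diff mx0.
set l := m%:R * x in mx0 sl tl tb *.
pose u (k : nat) : R := k%:R / m%:R.
pose r i j := g (u (minn i j)) - g x - dg x * (u (minn i j) - x).
have rle i j : `|r i j| <= M * ((u i - x) ^+ 2 * 1 + 1 * (u j - x) ^+ 2).
  apply: le_trans (taylor1_halfline cg cdg gdg dgd2g d2M x0 (node_ge0 _ _)) _.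
  rewrite mul1r mulr1 ler_wpM2l//.
  by case: (leqP i j) => _; rewrite ?lerDl ?lerDr sqr_ge0.
(* For finite [N] the total mass is a square of [psum l (fun=> 1) N], not yet 1, so the constant and
   linear terms keep such factors until the limit. *)
have rE N : psum2 l r N = psum2 l (fun i j => g (u (minn i j))) N
    - g x * (psum l (fun=> 1) N * psum l (fun=> 1) N)
    - dg x * (psum l (fun k => u k - x) N * psum l (fun=> 1) N)
    + dg x / (2 * m%:R) * psum2 l (fun i j => `|i%:R - j%:R|) N.
  have {1}-> : r = fun i j => g (u (minn i j)) + - g x * (1 * 1)
      + - dg x * (2^-1 * ((u i - x) * 1 + 1 * (u j - x)))
      + dg x / (2 * m%:R) * `|i%:R - j%:R|.
    apply/funext => i; apply/funext => j; rewrite /r.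
    suff -> : u (minn i j) - x = 2^-1 * ((u i - x) * 1 + 1 * (u j - x)) -
        (2 * m%:R)^-1 * `|i%:R - j%:R| by ring.
    rewrite /u; have [ij|/ltnW ji] := leqP i j.
      by rewrite distrC ger0_norm ?subr_ge0 ?ler_nat//; field; rewrite gt_eqF.
    by rewrite ger0_norm ?subr_ge0 ?ler_nat//; field; rewrite gt_eqF.
  rewrite 3!psum2D !psum2Z psum2D.
  have -> : psum2 l (fun _ _ => 1) N = psum l (fun=> 1) N * psum l (fun=> 1) N.
    rewrite -psum2_prod; congr (psum2 _ _ _).
    by apply/funext => i; apply/funext => j; rewrite mulr1.
  have -> : psum2 l (fun i _ => (u i - x) * 1) N =
      psum l (fun k => u k - x) N * psum l (fun=> 1) N by exact: psum2_prod.
  have -> : psum2 l (fun _ j => 1 * (u j - x)) N =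
      psum l (fun=> 1) N * psum l (fun k => u k - x) N by exact: psum2_prod.
  by field; rewrite gt_eqF.
have h1 : psum2 l r @ \oo --> s - g x * (1 * 1) - dg x * (0 * 1) + dg x / (2 * m%:R) * t.
  rewrite (funext rE).
  have c1 := @psum_cst1 R l.
  have c0 := psum_dilated_dev x m0.
  apply: cvgnD; last by apply: cvgnM tl; exact: cvg_cst.
  apply: cvgnB; last by apply: cvgnM (cvgnM c0 c1); exact: cvg_cst.
  by apply: cvgnB sl _; apply: cvgnM (cvgnM c1 c1); exact: cvg_cst.
have h2 : psum2 l (fun i j => M * ((u i - x) ^+ 2 * 1 + 1 * (u j - x) ^+ 2)) @ \oo -->
    M * (x / m%:R * 1 + 1 * (x / m%:R)).
  have c1 := @psum_cst1 R l.
  have c2 := psum_dilated_var (x := x) m0.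
  rewrite (_ : psum2 l _ = fun N => M * (psum l (fun k => (u k - x) ^+ 2) N * psum l (fun=> 1) N
    + psum l (fun=> 1) N * psum l (fun k => (u k - x) ^+ 2) N)); last first.
    apply/funext => N; rewrite psum2Z psum2D.
    by congr (_ * (_ + _)); exact: psum2_prod.
  apply: cvgnM; first exact: cvg_cst.
  exact: cvgnD (cvgnM c2 c1) (cvgnM c1 c2).
have := ler_cvg_to (cvg_norm h1) h2 (nearW _ (fun N => psum2_norm_le N mx0 rle)).
set q := Num.sqrt m%:R => h3.
have q0 : 0 < q by rewrite sqrtr_gt0.
have q2 : m%:R = q ^+ 2 by rewrite sqr_sqrtr// ltW.
have lE : Num.sqrt (l / pi) = q * Num.sqrt (x / pi) by rewrite -mulrA sqrtrM// ltW.
rewrite {}lE in tb; rewrite /VS; move: (Num.sqrt (x / pi)) tb => y tb.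
have -> : q * (g x - s) - dg x * y = - (q * (s - g x * (1 * 1) - dg x * (0 * 1) +
    dg x / (2 * m%:R) * t)) + dg x / (2 * q) * (t - 2 * (q * y)).
  by rewrite q2; field; rewrite gt_eqF.
apply: le_trans (ler_normD _ _) _; rewrite normrN !normrM.
have -> : (2 * M * x + 2 * `|dg x|) / q =
    q * (M * (x / m%:R * 1 + 1 * (x / m%:R))) + `|dg x| / (2 * q) * 4.
  by rewrite q2; field; rewrite gt_eqF.
have q20 : 0 < 2 * q by rewrite mulr_gt0.
rewrite (gtr0_norm q0) normfV (gtr0_norm q20).
apply: lerD.
  rewrite ler_pM2l//; exact: h3.
by rewrite ler_wpM2l// divr_ge0// mulr_ge0// ltW.
Qed.

End poisson_smoothing.

(** * Empirical averages *)

Section bounded_expectation.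
Context d (T : measurableType d) (R : realType) (P : probability T R).
Implicit Types g h : T -> R.

(** A class closed under sums and products on which every expectation is a finite real integral, so
    that linearity leaves no integrability conditions. *)
Definition bounded_measurable g :=
  measurable_fun setT g /\ exists M, forall w, `|g w| <= M.

Lemma bounded_measurable_integrable g :
  bounded_measurable g -> P.-integrable setT (EFin \o g).
Proof.
move=> [mg [M gM]]; apply: (measurable_bounded_integrable measurableT) => //.
  by apply: (le_lt_trans (probability_le1 P measurableT)); rewrite ltry.
exists M; split; first exact: num_real.
by move=> x Mx w _ /=; exact: le_trans (gM w) (ltW Mx).
Qed.

Lemma bounded_measurable_cst c : bounded_measurable (fun=> c).
Proof. by split; [exact: measurable_cst|exists `|c|]. Qed.

Lemma bounded_measurableD g h : bounded_measurable g -> bounded_measurable h ->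
  bounded_measurable (fun w => g w + h w).
Proof.
move=> [mg [M gM]] [mh [N hN]]; split; first exact: measurable_funD.
by exists (M + N) => w; rewrite (le_trans (ler_normD _ _))// lerD.
Qed.

Lemma bounded_measurableM g h : bounded_measurable g -> bounded_measurable h ->
  bounded_measurable (fun w => g w * h w).
Proof.
move=> [mg [M gM]] [mh [N hN]]; split; first exact: measurable_funM.
by exists (M * N) => w; rewrite normrM ler_pM.
Qed.

Lemma bounded_measurable_sum (I : Type) (r : seq I) (g : I -> T -> R) :
  (forall i, bounded_measurable (g i)) ->
  bounded_measurable (fun w => \sum_(i <- r) g i w).
Proof.
move=> bg; elim: r => [|i r IH].
  by under eq_fun do rewrite big_nil; exact: bounded_measurable_cst.
by under eq_fun do rewrite big_cons; exact: bounded_measurableD.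
Qed.

Lemma bounded_Rintegral_sum (I : Type) (r : seq I) (g : I -> T -> R) :
  (forall i, bounded_measurable (g i)) ->
  \int[P]_w (\sum_(i <- r) g i w) = \sum_(i <- r) \int[P]_w g i w.
Proof.
move=> bg; elim: r => [|i r IH].
  under eq_Rintegral do rewrite big_nil.
  by rewrite big_nil Rintegral_cst// mul0r.
under eq_Rintegral do rewrite big_cons.
rewrite big_cons RintegralD//; first by rewrite IH.
- exact: bounded_measurable_integrable.
- exact/bounded_measurable_integrable/bounded_measurable_sum.
Qed.

Lemma bounded_RintegralZ g c : bounded_measurable g ->
  \int[P]_w (c * g w) = c * \int[P]_w g w.
Proof. by move=> bg; rewrite RintegralZl//; exact: bounded_measurable_integrable. Qed.

Lemma bounded_RintegralD g h : bounded_measurable g -> bounded_measurable h ->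
  \int[P]_w (g w + h w) = \int[P]_w g w + \int[P]_w h w.
Proof. by move=> bg bh; rewrite RintegralD//; exact: bounded_measurable_integrable. Qed.

Lemma probability_Rintegral_cst c : \int[P]_w c = c.
Proof. by rewrite Rintegral_cst//= (congr1 fine (probability_setT P)) mulr1. Qed.

Lemma bounded_expectation g : bounded_measurable g ->
  ('E_P[g])%E = (\int[P]_w g w)%:E.
Proof.
move=> bg; rewrite /Rintegral fineK ?unlock//.
exact/integrable_fin_num/bounded_measurable_integrable.
Qed.

Lemma bounded_convergence (g : nat -> T -> R) h M :
  (forall N, measurable_fun setT (g N)) -> (forall N w, `|g N w| <= M) ->
  (forall w, g N w @[N --> \oo] --> h w) ->
  bounded_measurable h /\ \int[P]_w g N w @[N --> \oo] --> \int[P]_w h w.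
Proof.
move=> mg gM gh.
have mh : measurable_fun setT h by exact: measurable_fun_cvg (fun w _ => gh w).
have bh : bounded_measurable h.
  split => //; exists M => w; apply: (ler_cvg_to (cvg_norm (gh w)) (cvg_cst M)).
  exact: nearW.
split => //.
have [] := @dominated_convergence _ T R P setT measurableT (fun N => EFin \o g N)
    (EFin \o h) (EFin \o (fun=> M)).
- by move=> N; exact/measurable_EFinP.
- exact/measurable_EFinP.
- apply: aeW => w _; apply: cvg_EFin; first exact: nearW.
  exact: gh.
- exact/bounded_measurable_integrable/bounded_measurable_cst.
- by apply: aeW => w N _; rewrite /= lee_fin.
move=> _ _ cv; apply: fine_cvg; rewrite fineK//.
exact/integrable_fin_num/bounded_measurable_integrable.
Qed.

(** Bias-variance decomposition from the means and the pairwise product means alone: n diagonal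
    terms and n (n - 1) others. It serves both estimators, with [below] and with [szasz_term] as
    summands. *)
Lemma mean_square_error (Y : nat -> T -> R) (mu1 mu2 c : R) n : (0 < n)%N ->
  (forall i, bounded_measurable (Y i)) ->
  (forall i, \int[P]_w Y i w = mu1) ->
  (forall i j, \int[P]_w (Y i w * Y j w) = if i == j then mu2 else mu1 ^+ 2) ->
  \int[P]_w ((n%:R^-1 * \sum_(i < n) Y i w - c) ^+ 2) =
    (mu2 - mu1 ^+ 2) / n%:R + (mu1 - c) ^+ 2.
Proof.
move=> n0 bY Y1 Y2; have nr0 : n%:R != 0 :> R by rewrite pnatr_eq0 -lt0n.
have bS := bounded_measurable_sum (index_enum 'I_n) (fun i => bY (nat_of_ord i)).
have bSS := bounded_measurable_sum (index_enum 'I_n) (fun i =>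
  bounded_measurable_sum (index_enum 'I_n) (fun j =>
    bounded_measurableM (bY (nat_of_ord i)) (bY (nat_of_ord j)))).
transitivity (\int[P]_w ((n%:R ^- 2 * (\sum_(i < n) \sum_(j < n) Y i w * Y j w) +
    (- 2 * c / n%:R) * \sum_(i < n) Y i w) + c ^+ 2)).
  apply: eq_Rintegral => w _.
  have -> : \sum_(i < n) \sum_(j < n) Y i w * Y j w = (\sum_(i < n) Y i w) ^+ 2.
    by rewrite expr2 mulr_suml; apply: eq_bigr => i _; rewrite mulr_sumr.
  by field.
have bc := bounded_measurable_cst.
rewrite bounded_RintegralD//; last first.
  by apply: bounded_measurableD; apply: bounded_measurableM.
rewrite bounded_RintegralD//; [|exact: bounded_measurableM..].
rewrite !bounded_RintegralZ// probability_Rintegral_cst.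
rewrite 2?bounded_Rintegral_sum//; last first.
  by move=> i; apply: bounded_measurable_sum => j; exact: bounded_measurableM.
have -> : \sum_(i < n) \int[P]_w Y i w = n%:R * mu1.
  by under eq_bigr do rewrite Y1; rewrite sumr_const card_ord mulr_natl.
have -> : \sum_(i < n) \int[P]_w (\sum_(j < n) Y i w * Y j w) =
    n%:R * (mu2 + n.-1%:R * mu1 ^+ 2).
  transitivity (\sum_(i < n) (mu2 + n.-1%:R * mu1 ^+ 2)); last first.
    by rewrite sumr_const card_ord -[LHS]mulr_natl.
  apply: eq_bigr => i _; rewrite bounded_Rintegral_sum; last first.
    by move=> j; exact: bounded_measurableM.
  rewrite (bigD1 i)//= Y2 eqxx; congr (_ + _).
  rewrite (eq_bigr (fun=> mu1 ^+ 2)); last first.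
    by move=> j ji; rewrite Y2 eq_sym (inj_eq val_inj) (negbTE ji).
  by rewrite sumr_const cardC1 card_ord mulr_natl.
have nE : n%:R = n.-1%:R + 1 :> R by rewrite natr1 prednK.
by rewrite nE in nr0 *; field.
Qed.

End bounded_expectation.

(** * Moments of the indicators of the observations *)

Section estimators.
Context d (T : measurableType d) (R : realType) (P : probability T R).
Variables (X : nat -> {RV P >-> R}) (F : R -> R).
Hypothesis X_iid : iid_with_cdf X F.

Definition below i (t : R) (w : T) : R := (X i w <= t)%R%:R.

Lemma belowE i t : below i t = \1_(X i @^-1` `]-oo, t]).
Proof.
apply/funext => w; rewrite /below indicE; congr ((nat_of_bool _)%:R); apply/idP/idP.
  by move=> Xt; rewrite inE/= in_itv.
by rewrite inE/= in_itv.
Qed.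

Lemma measurable_preimage_below i t : measurable (X i @^-1` `]-oo, t]).
Proof. exact: measurable_funPTI. Qed.

Lemma bounded_measurable_below i t : bounded_measurable (below i t).
Proof.
split; first by rewrite belowE; exact/measurable_indic/measurable_preimage_below.
by exists 1 => w; rewrite /below normr_nat (ler_nat R _ 1) leq_b1.
Qed.

Lemma prob_below i t : P (X i @^-1` `]-oo, t]) = (F t)%:E.
Proof. by have [_ /(_ i)<-] := X_iid. Qed.

Lemma cdf_bounds t : 0 <= F t <= 1.
Proof.
have := prob_below 0 t => PF; rewrite -!lee_fin -PF probability_le1 ?measure_ge0//.
exact: measurable_preimage_below.
Qed.

Lemma cdf_monotone : {homo F : s t / s <= t}.
Proof.
move=> s t st; rewrite -lee_fin -!(prob_below 0) le_measure ?inE//;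
  try exact: measurable_preimage_below.
by move=> w /=; rewrite !in_itv/= => /le_trans; exact.
Qed.

Lemma mean_below i t : \int[P]_w below i t w = F t.
Proof.
rewrite belowE /Rintegral integral_indic//; last exact: measurable_preimage_below.
by rewrite setIT (congr1 fine (prob_below i t)).
Qed.

Lemma mean_below2 i j s t :
  \int[P]_w (below i s w * below j t w) = if i == j then F (Num.min s t) else F s * F t.
Proof.
have [->|ij] := eqVneq i j.
  rewrite -(mean_below j); apply: eq_Rintegral => w _.
  by rewrite /below le_min -natrM mulnb.
have [indep _] := X_iid.
(* Independence is stated for families indexed by all of [nat]; outside the pair {i, j} the choice
   is arbitrary. *)
pose A k : set R := if k == i then `]-oo, s]%classic else `]-oo, t]%classic.
have mA k : measurable (A k) by rewrite /A; case: ifP.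
have := indep [fset i; j]%fset A mA.
rewrite big_fsetU1 ?inE// big_seq_fset1 /A eqxx eq_sym (negbTE ij).
rewrite !prob_below /= -EFinM => PE.
rewrite (_ : (fun w => _) = \1_(X i @^-1` `]-oo, s] `&` X j @^-1` `]-oo, t])); last first.
  by apply/funext => w; rewrite !belowE indicI.
rewrite /Rintegral integral_indic//; last first.
  by apply: measurableI; exact: measurable_preimage_below.
rewrite setIT -[RHS]/(fine (F s * F t)%:E) -PE; congr (fine (P _)).
apply/seteqP; split => [w [ws wt] k /=|w H].
  by rewrite !inE => /orP[]/eqP->; rewrite ?eqxx// eq_sym (negbTE ij).
split; [have := H i|have := H j].
  by rewrite /= !inE !eqxx; exact.
by rewrite /= !inE !eqxx orbT eq_sym (negbTE ij); exact.
Qed.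

End estimators.

(** * The Szasz estimator *)

Lemma cvgn_unique (R : realType) (g : nat -> R) (l k : R) :
  g @ \oo --> l -> g @ \oo --> k -> l = k.
Proof. by move=> /cvg_lim <-// /cvg_lim <-. Qed.

Lemma cvgn_sum (R : realType) (I : Type) (r : seq I) (g : I -> nat -> R) (l : I -> R) :
  (forall i, g i @ \oo --> l i) ->
  \sum_(i <- r) g i n @[n --> \oo] --> \sum_(i <- r) l i.
Proof.
move=> gl; elim: r => [|i r IH].
  by under eq_fun do rewrite big_nil; rewrite big_nil; exact: cvg_cst.
by under eq_fun do rewrite big_cons; rewrite big_cons; exact: cvgnD.
Qed.

Section szasz_moments.
Context d (T : measurableType d) (R : realType) (P : probability T R).
Variables (X : nat -> {RV P >-> R}) (F : R -> R).
Hypothesis X_iid : iid_with_cdf X F.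

Definition szasz_partial (m : nat) (x : R) i N (w : T) : R :=
  psum (m%:R * x) (fun k => below X i (k%:R / m%:R) w) N.

Definition szasz_term (m : nat) (x : R) i (w : T) : R :=
  limn (fun N => szasz_partial m x i N w).

Lemma below_norm_le1 i t w : `|below X i t w| <= 1.
Proof. by rewrite /below normr_nat (ler_nat R _ 1) leq_b1. Qed.

Lemma szasz_partial_cvg m x i w : 0 <= x ->
  szasz_partial m x i N w @[N --> \oo] --> szasz_term m x i w.
Proof.
move=> x0; have mx0 : 0 <= m%:R * x by rewrite mulr_ge0.
apply: (psum_dominated mx0 (fun k => below_norm_le1 i (k%:R / m%:R) w)).
by apply/cvg_ex; exists 1; exact: psum_cst1.
Qed.

Lemma szasz_partial_norm_le1 m x i N w : 0 <= x -> `|szasz_partial m x i N w| <= 1.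
Proof.
move=> x0; have mx0 : 0 <= m%:R * x by rewrite mulr_ge0.
apply: le_trans (ler_norm_sum _ _ _) _.
apply: le_trans (psum_le_lim N mx0 (fun=> ler01) (@psum_cst1 R (m%:R * x))).
apply: ler_sum => k _; rewrite normrM (ger0_norm (pois_ge0 _ _))// ler_wpM2r ?pois_ge0//.
exact: below_norm_le1.
Qed.

Lemma szasz_term_norm_le1 m x i w : 0 <= x -> `|szasz_term m x i w| <= 1.
Proof.
move=> x0; apply: (ler_cvg_to (cvg_norm (@szasz_partial_cvg m x i w x0)) (cvg_cst (1 : R))).
by apply: nearW => N; exact: szasz_partial_norm_le1.
Qed.

Lemma szaszE m n x w : 0 <= x ->
  szasz X m n w x = n%:R^-1 * \sum_(i < n) szasz_term m x i w.
Proof.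
move=> x0; rewrite /szasz; apply: cvg_lim => //.
rewrite (_ : series _ = fun N => n%:R^-1 * \sum_(i < n) szasz_partial m x i N w).
  apply: cvgnM; first exact: cvg_cst.
  by apply: cvgn_sum => i; exact: szasz_partial_cvg.
apply/funext => N; rewrite exchange_big/= mulr_sumr; apply: eq_bigr => k _.
by rewrite /ecdf -mulrA mulr_suml.
Qed.

Lemma bounded_measurable_partial m x i N : bounded_measurable (szasz_partial m x i N).
Proof.
apply: bounded_measurable_sum => k; apply: bounded_measurableM.
  exact: bounded_measurable_below.
exact: bounded_measurable_cst.
Qed.

(** The partial sums are bounded by the total Poisson mass 1, so bounded convergence exchanges the
    expectation with the series. *)
Lemma szasz_term_mean m x i : 0 <= x ->
  bounded_measurable (szasz_term m x i) /\
  psum (m%:R * x) (fun k => F (k%:R / m%:R)) @ \oo --> \int[P]_w szasz_term m x i w.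
Proof.
move=> x0; have [bt cv] := bounded_convergence P
  (fun N => (bounded_measurable_partial m x i N).1)
  (fun N w => @szasz_partial_norm_le1 m x i N w x0)
  (fun w => @szasz_partial_cvg m x i w x0).
split => //; apply: near_cvgn cv _; near=> N.
rewrite bounded_Rintegral_sum; last first.
  by move=> k; apply: bounded_measurableM;
    [exact: bounded_measurable_below|exact: bounded_measurable_cst].
apply: eq_bigr => k _; under eq_Rintegral do rewrite mulrC.
by rewrite bounded_RintegralZ ?(mean_below X_iid) 1?mulrC//; exact: bounded_measurable_below.
Unshelve. all: by end_near. Qed.

Lemma szasz_term_mean_mul m x i j : 0 <= x ->
  psum2 (m%:R * x) (fun k l => if i == j then F ((minn k l)%:R / m%:R)
    else F (k%:R / m%:R) * F (l%:R / m%:R)) @ \oo -->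
  \int[P]_w (szasz_term m x i w * szasz_term m x j w).
Proof.
move=> x0; have [|||_ cv] := @bounded_convergence _ _ _ P
  (fun N w => szasz_partial m x i N w * szasz_partial m x j N w)
  (fun w => szasz_term m x i w * szasz_term m x j w) 1.
- move=> N; apply: measurable_funM; exact: (bounded_measurable_partial m x _ N).1.
- by move=> N w; rewrite normrM mulr_ile1// szasz_partial_norm_le1.
- by move=> w; apply: cvgnM; exact: szasz_partial_cvg.
apply: near_cvgn cv _; near=> N.
under eq_Rintegral => w _.
  rewrite -(psum2_prod _ (fun k => below X i (k%:R / m%:R) w)
    (fun k => below X j (k%:R / m%:R) w)).
  over.
have bb s t : bounded_measurable (fun w => below X i s w * below X j t w).
  by apply: bounded_measurableM; exact: bounded_measurable_below.
have bc := @bounded_measurable_cst _ T R.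
rewrite bounded_Rintegral_sum; last first.
  by move=> k; apply: bounded_measurable_sum => l; exact: bounded_measurableM.
apply: eq_bigr => k _; rewrite bounded_Rintegral_sum; last first.
  by move=> l; exact: bounded_measurableM.
apply: eq_bigr => l _; under eq_Rintegral do rewrite mulrC.
rewrite bounded_RintegralZ// (mean_below2 X_iid) mulrC; congr (_ * _); case: ifP => // _.
congr F; rewrite -minr_pMl ?invr_ge0//; congr (_ / _).
by case: (leqP k l) => kl; [apply/min_idPl|apply/min_idPr]; rewrite ler_nat// ltnW.
Unshelve. all: by end_near. Qed.

(** M1 of the overview; its convergence is inherited from [szasz_term_mean], where the limit is an
    expectation. *)
Definition smooth_mean m x := limn (psum (m%:R * x) (fun k => F (k%:R / m%:R))).

Definition smooth_mean2 m x :=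
  limn (psum2 (m%:R * x) (fun k l => F ((minn k l)%:R / m%:R))).

Lemma smooth_mean_cvg m x : 0 <= x ->
  psum (m%:R * x) (fun k => F (k%:R / m%:R)) @ \oo --> smooth_mean m x.
Proof. by move=> x0; have [_ /cvgP] := szasz_term_mean m 0 x0. Qed.

Lemma smooth_mean2_cvg m x : 0 <= x ->
  psum2 (m%:R * x) (fun k l => F ((minn k l)%:R / m%:R)) @ \oo --> smooth_mean2 m x.
Proof. by move=> x0; have /cvgP := @szasz_term_mean_mul m x 0 0 x0. Qed.

Lemma szasz_mean_square_error m n x : (0 < n)%N -> 0 <= x ->
  \int[P]_w ((szasz X m n w x - F x) ^+ 2) =
  (smooth_mean2 m x - smooth_mean m x ^+ 2) / n%:R + (smooth_mean m x - F x) ^+ 2.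
Proof.
move=> n0 x0; under eq_Rintegral do rewrite szaszE//.
apply: mean_square_error => //.
- by move=> i; have [] := szasz_term_mean m i x0.
- move=> i; have [_ h] := szasz_term_mean m i x0.
  exact: cvgn_unique h (@smooth_mean_cvg m x x0).
- move=> i j; have := @szasz_term_mean_mul m x i j x0; case: ifP => _ h.
    exact: cvgn_unique h (@smooth_mean2_cvg m x x0).
  apply: (cvgn_unique h); rewrite expr2.
  have c := @smooth_mean_cvg m x x0; have := cvgnM c c.
  by under eq_fun do rewrite -psum2_prod.
Qed.

Lemma ecdf_mean_square_error n x : (0 < n)%N ->
  \int[P]_w ((ecdf X n w x - F x) ^+ 2) = sigma2 F x / n%:R.
Proof.
move=> n0; transitivity ((F x - F x ^+ 2) / n%:R + (F x - F x) ^+ 2).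
  apply: (@mean_square_error _ _ _ _ (fun i w => below X i x w)) => //.
  - by move=> i; exact: bounded_measurable_below.
  - by move=> i; exact: mean_below.
  - by move=> i j; rewrite (mean_below2 X_iid); case: ifP => // _; rewrite minxx.
by rewrite subrr expr0n addr0 /sigma2; congr (_ / _); ring.
Qed.

Lemma bounded_measurable_szasz m n x : 0 <= x ->
  bounded_measurable (fun w => szasz X m n w x).
Proof.
move=> x0; under eq_fun do rewrite szaszE//.
apply: bounded_measurableM; first exact: bounded_measurable_cst.
by apply: bounded_measurable_sum => i; have [] := szasz_term_mean m i x0.
Qed.

Lemma bounded_measurable_ecdf n x : bounded_measurable (fun w => ecdf X n w x).
Proof.
apply: bounded_measurableM; first exact: bounded_measurable_cst.
by apply: bounded_measurable_sum => i; exact: bounded_measurable_below.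
Qed.

Lemma MSE_bounded (est : T -> R -> R) x : bounded_measurable (est ^~ x) ->
  MSE P est F x = (\int[P]_w ((est w x - F x) ^+ 2))%:E.
Proof.
move=> be; rewrite /MSE bounded_expectation//.
have b1 := bounded_measurableD be (bounded_measurable_cst T (- F x)).
exact: (bounded_measurableM b1 b1).
Qed.

Lemma iL_eq m n x : (0 < n)%N -> 0 <= x ->
  iL X F m n x = nat_min [set k | (0 < k)%N /\ sigma2 F x / k%:R <=
   (smooth_mean2 m x - smooth_mean m x ^+ 2) / n%:R + (smooth_mean m x - F x) ^+ 2].
Proof.
move=> n0 x0; rewrite /iL; congr nat_min; apply/seteqP; split => k /= [k0];
  rewrite (MSE_bounded (bounded_measurable_ecdf k x))
    (MSE_bounded (bounded_measurable_szasz m n x0))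
    ecdf_mean_square_error// szasz_mean_square_error// lee_fin; by split.
Qed.

End szasz_moments.

(** * Weighted integrals *)

Section weighted_integral.
Context {R : realType}.
Variables (f : R -> R) (a M : R).
Hypotheses (a_gt0 : 0 < a) (cf : {within `[0, +oo[, continuous f})
  (f_bound : forall x, 0 <= x -> `|f x| <= M).

Local Notation D := (`[0, +oo[%classic : set R).
Local Notation mu := (@lebesgue_measure R).

Let mD : measurable D. Proof. exact: measurable_itv. Qed.

Let DE (x : R) : D x = (0 <= x). Proof. by rewrite /= in_itv/= andbT. Qed.

Lemma measurable_expRM (c : R) (A : set R) : measurable_fun A (fun x => expR (c * x)).
Proof.
apply: measurable_funTS.
have h : continuous (fun x : R => expR (c * x)).
  move=> x; apply: (@continuous_comp _ _ _ (fun x : R => c * x) expR); last exact: continuous_expR.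
  by apply: cvgMr; exact: cvg_id.
exact: continuous_measurable_fun.
Qed.

(** Read off from the total mass 1 of the exponential density. *)
Lemma integrable_expRN (c : R) : 0 < c ->
  mu.-integrable D (EFin \o (fun x => expR (- (c * x)))).
Proof.
move=> c0.
have H : (\int[mu]_(x in D) (c * expR (- c * x))%:E = 1)%E.
  rewrite -(integral_exponential_pdf c0) [LHS]integral_mkcond.
  by apply: eq_integral => x _; rewrite restrict_EFin.
have -> : EFin \o (fun x => expR (- (c * x))) =
    EFin \o (fun x => c^-1 * (c * expR (- c * x))).
  by apply/funext => x; rewrite /= mulNr mulKf ?gt_eqF.
apply: integrableZ_EFin => //; apply/integrableP; split.
  apply/measurable_EFinP; apply: measurable_funM; first exact: measurable_cst.
  exact: measurable_expRM.
rewrite (_ : (\int[_]_(x in _) _)%E = 1%E); first exact: ltry.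
rewrite -[RHS]H; apply: eq_integral => x _; rewrite /= ger0_norm//.
by rewrite mulr_ge0 ?expR_ge0// ltW.
Qed.

Lemma quadratic_le_expR (c : R) : 0 < c ->
  exists2 K, 0 <= K & forall x, 0 <= x -> (1 + x) ^+ 2 <= K * expR (c * x).
Proof.
(* This choice gives b (1 + x) <= 1 + c x / 2 <= exp (c x / 2), to be squared. *)
move=> c0; set b := Num.min 1 (c / 2).
have b0 : 0 < b by rewrite lt_min ltr01 divr_gt0.
exists (b ^- 2); first by rewrite invr_ge0 sqr_ge0.
move=> x x0; rewrite mulrC ler_pdivlMr ?exprn_gt0// -exprMn.
have -> : c * x = (c / 2 * x) *+ 2 by rewrite mulr2n; field.
rewrite -mulr_natr expRM_natr.
apply: lerXn2r; rewrite ?nnegrE ?expR_ge0//.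
  by rewrite mulr_ge0 ?addr_ge0// ltW.
apply: le_trans (expR_ge1Dx _); rewrite mulrDl mul1r lerD//.
  by rewrite ge_min lexx.
by rewrite mulrC ler_wpM2r// ge_min lexx orbT.
Qed.

Let measurable_f : measurable_fun D f.
Proof. exact: subspace_continuous_measurable_fun. Qed.

Lemma measurable_weighted (g : R -> R) : measurable_fun D g ->
  measurable_fun D (fun x => g x * expR (- (a * x)) * f x).
Proof.
move=> mg; apply: measurable_funM => //; apply: measurable_funM => //.
have -> : (fun x => expR (- (a * x))) = (fun x => expR (- a * x)).
  by apply/funext => x; rewrite mulNr.
exact: measurable_expRM.
Qed.

(** Half of the exponential weight absorbs the quadratic growth and the other half stays integrable.
    [K] is chosen before [g], so that one majorant serves a whole sequence. *)
Lemma weight_majorant (C : R) : 0 <= C ->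
  exists2 K, 0 <= K & forall g : R -> R, (forall x, 0 <= x -> `|g x| <= C * (1 + x) ^+ 2) ->
  forall x, 0 <= x -> `|g x * expR (- (a * x)) * f x| <= K * expR (- (a / 2 * x)).
Proof.
move=> C0; have a2 : 0 < a / 2 by rewrite divr_gt0.
have M0 : 0 <= M by exact: le_trans (normr_ge0 _) (f_bound (lexx 0)).
have [K K0 HK] := quadratic_le_expR a2.
exists (C * K * M); first by rewrite !mulr_ge0.
move=> g gC x x0; rewrite !normrM (ger0_norm (expR_ge0 _)).
have -> : expR (- (a * x)) = expR (- (a / 2 * x)) * expR (- (a / 2 * x)).
  by rewrite -expRD; congr expR; field.
have e0 := expR_ge0 (- (a / 2 * x)).
have h1 : `|g x| * expR (- (a / 2 * x)) <= C * K.
  rewrite (@le_trans _ _ (C * (K * expR (a / 2 * x)) * expR (- (a / 2 * x))))//.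
    rewrite ler_wpM2r// (le_trans (gC x x0))// ler_wpM2l//; exact: HK.
  by rewrite -!mulrA -expRD subrr expR0 mulr1.
rewrite [leLHS](_ : _ = (`|g x| * expR (- (a / 2 * x))) * `|f x| * expR (- (a / 2 * x)));
  last by ring.
by rewrite ler_wpM2r// ler_pM ?mulr_ge0 ?f_bound.
Qed.

Lemma integrable_weighted (C : R) (g : R -> R) : 0 <= C -> measurable_fun D g ->
  (forall x, 0 <= x -> `|g x| <= C * (1 + x) ^+ 2) ->
  mu.-integrable D (EFin \o (fun x => g x * expR (- (a * x)) * f x)).
Proof.
move=> C0 mg gC; have [K K0 HK] := weight_majorant C0.
have a2 : 0 < a / 2 by rewrite divr_gt0.
have ik : mu.-integrable D (EFin \o (fun x => K * expR (- (a / 2 * x)))).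
  by apply: integrableZ_EFin => //; exact: integrable_expRN.
apply: le_integrable ik => //.
  by apply/measurable_EFinP; exact: measurable_weighted.
move=> x Dx; rewrite /= !lee_fin [leRHS]ger0_norm ?mulr_ge0 ?expR_ge0//.
by apply: HK => //; rewrite -DE.
Qed.

Lemma weighted_integral_cvg (C : R) (G : nat -> R -> R) (g : R -> R) : 0 <= C ->
  (forall n, measurable_fun D (G n)) ->
  (forall n x, 0 <= x -> `|G n x| <= C * (1 + x) ^+ 2) ->
  (forall x, 0 <= x -> G n x @[n --> \oo] --> g x) ->
  weighted_integral f a (G n) @[n --> \oo] --> weighted_integral f a g.
Proof.
move=> C0 mG GC Gg; have [K K0 HK] := weight_majorant C0.
have a2 : 0 < a / 2 by rewrite divr_gt0.
have mg : measurable_fun D g.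
  by apply: measurable_fun_cvg mG _ => x Dx; apply: Gg; rewrite -DE.
have gC x : 0 <= x -> `|g x| <= C * (1 + x) ^+ 2.
  move=> x0; apply: (ler_cvg_to (cvg_norm (Gg x x0)) (cvg_cst (C * (1 + x) ^+ 2))).
  by apply: nearW => n; exact: GC.
have [] := @dominated_convergence _ _ R mu D mD
  (fun n => EFin \o (fun x => G n x * expR (- (a * x)) * f x))
  (EFin \o (fun x => g x * expR (- (a * x)) * f x))
  (EFin \o (fun x => K * expR (- (a / 2 * x)))).
- by move=> n; apply/measurable_EFinP; exact: measurable_weighted.
- by apply/measurable_EFinP; exact: measurable_weighted.
- apply: aeW => x Dx; apply: cvg_EFin; first exact: nearW.
  apply: cvgnM; last exact: cvg_cst.
  by apply: cvgnM; [apply: Gg; rewrite -DE|exact: cvg_cst].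
- by apply: integrableZ_EFin => //; exact: integrable_expRN.
- by apply: aeW => x n Dx; rewrite /= lee_fin; apply: HK; [exact: GC|rewrite -DE].
move=> _ _ cv; apply: fine_cvg; rewrite fineK//.
exact/integrable_fin_num/(integrable_weighted C0 mg gC).
Qed.

Lemma weighted_integralD (C : R) (g h : R -> R) : 0 <= C ->
  measurable_fun D g -> measurable_fun D h ->
  (forall x, 0 <= x -> `|g x| <= C * (1 + x) ^+ 2) ->
  (forall x, 0 <= x -> `|h x| <= C * (1 + x) ^+ 2) ->
  weighted_integral f a (fun x => g x + h x) =
  weighted_integral f a g + weighted_integral f a h.
Proof.
move=> C0 mg mh gC hC; rewrite -RintegralD//; [|exact: (integrable_weighted C0)..].
by apply: eq_Rintegral => x _; ring.
Qed.

Lemma weighted_integralZ (C c : R) (g : R -> R) : 0 <= C ->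
  measurable_fun D g -> (forall x, 0 <= x -> `|g x| <= C * (1 + x) ^+ 2) ->
  weighted_integral f a (fun x => c * g x) = c * weighted_integral f a g.
Proof.
move=> C0 mg gC; rewrite -RintegralZl//; last exact: (integrable_weighted C0).
by apply: eq_Rintegral => x _; ring.
Qed.

(** By continuity the integrand stays above half its value at [c] on a short interval to the right
    of [c], which remains in the half-line. *)
Lemma weighted_integral_gt0 (g : R -> R) (C c : R) : 0 <= C ->
  measurable_fun D g -> (forall x, 0 <= x -> `|g x| <= C * (1 + x) ^+ 2) ->
  (forall x, 0 <= x -> 0 <= g x) -> (forall x, 0 <= x -> 0 <= f x) ->
  0 < c -> 0 < g c -> 0 < f c -> {for c, continuous g} -> {for c, continuous f} ->
  0 < weighted_integral f a g.
Proof.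
move=> C0 mg gC g0 f0 c0 gc fc cgc cfc.
pose k x := g x * expR (- (a * x)) * f x.
have kc : 0 < k c by rewrite !mulr_gt0 ?expR_gt0.
have ck : {for c, continuous k}.
  apply: cvgM cfc; apply: cvgM cgc _.
  apply: (@continuous_comp _ _ _ (fun x => - (a * x)) expR); last exact: continuous_expR.
  by apply: cvgN; apply: cvgMr; exact: cvg_id.
have k0 x : D x -> 0 <= k x.
  by rewrite DE => x0; rewrite /k mulr_ge0 ?mulr_ge0 ?expR_ge0 ?g0 ?f0.
have : \forall t \near c, k c / 2 < k t.
  by apply: (cvgr_gt _ ck); rewrite ltr_pdivrMr// ltr_pMr// ltr1n.
move=> [e /= e0 He].
pose I := (`[c, c + e / 2]%classic : set R).
have ID : I `<=` D.
  by move=> x /=; rewrite !in_itv/= andbT => /andP[cx _]; rewrite (le_trans (ltW c0)).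
have mI : measurable I by exact: measurable_itv.
have ik := integrable_weighted C0 mg gC.
have lb : ((k c / 2 * (e / 2))%:E <= \int[mu]_(x in D) (k x)%:E)%E.
  apply: (@le_trans _ _ (\int[mu]_(x in I) (k c / 2)%:E)%E).
    rewrite integral_cst//= [mu _]lebesgue_measure_itv/= lte_fin ltrDl divr_gt0//.
    by rewrite -EFinD addrAC subrr add0r.
  apply: (@le_trans _ _ (\int[mu]_(x in I) (k x)%:E)%E); last first.
    apply: ge0_subset_integral => //.
      by apply/measurable_EFinP; exact: measurable_weighted.
  apply: ge0_le_integral => //.
  - by move=> x _; rewrite lee_fin divr_ge0// ltW.
  - apply: measurable_funS ID _ => //.
    by apply/measurable_EFinP; exact: measurable_weighted.
  move=> x; rewrite /I /= in_itv/= => /andP[cx xe]; rewrite lee_fin ltW// He//=.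
  by rewrite distrC ger0_norm ?subr_ge0//; lra.
rewrite -lte_fin /weighted_integral /Rintegral fineK ?integrable_fin_num//.
by apply: lt_le_trans lb; rewrite lte_fin mulr_gt0// divr_gt0.
Qed.

End weighted_integral.

(** * Integrated squared errors *)

Section mise.
Context d (T : measurableType d) (R : realType) (P : probability T R).
Variables (F f : R -> R) (a M : R).
Hypotheses (a_gt0 : 0 < a) (cF : continuous F) (F01 : forall x, 0 <= F x <= 1)
  (cf : {within `[0, +oo[, continuous f})
  (f_bound : forall x, 0 <= x -> `|f x| <= M) (f_ge0 : forall x, 0 <= x -> 0 <= f x).

Local Notation D := (`[0, +oo[%classic : set R).
Local Notation mu := (@lebesgue_measure R).

(* The absolute value makes joint measurability meaningful on the whole line,
   although estimators are only well behaved on the half-line. *)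
Lemma MISE_weighted (est : T -> R -> R) (v : R -> R) (C : R) : 0 <= C ->
  (forall w x, 0 <= x -> `|est w x| <= 1) ->
  measurable_fun setT (fun z : T * R => est z.1 `|z.2|) ->
  (forall x, 0 <= x -> \int[P]_w ((est w x - F x) ^+ 2) = v x) ->
  measurable_fun D v -> (forall x, 0 <= x -> `|v x| <= C * (1 + x) ^+ 2) ->
  MISE P est F f a = (weighted_integral f a v)%:E.
Proof.
move=> C0 est1 mest estv mv vC.
have mD : measurable D by exact: measurable_itv.
have DE (x : R) : D x = (0 <= x) by rewrite /= in_itv/= andbT.
have mF : measurable_fun setT F by exact: continuous_measurable_fun.
have mf : measurable_fun D f by exact: subspace_continuous_measurable_fun.
(* Extension of the density by zero makes the integrand [k] nonnegative and jointly measurable on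
   the whole product space, as Tonelli requires. *)
pose fD := f \_ D.
have mfD : measurable_fun setT fD by apply/(measurable_restrictT _ mD).
have fD0 x : 0 <= fD x.
  by rewrite /fD patchE; case: ifPn => //; rewrite inE DE => /f_ge0.
pose k (z : T * R) : R := (est z.1 `|z.2| - F z.2) ^+ 2 * expR (- a * z.2) * fD z.2.
have mk : measurable_fun setT k.
  apply: measurable_funM; last by apply: measurableT_comp => //; exact: measurable_snd.
  apply: measurable_funM.
    apply: measurable_funX; apply: measurable_funB => //.
    by apply: measurableT_comp => //; exact: measurable_snd.
  apply: (@measurableT_comp _ _ _ _ _ _ (fun x => expR (- a * x))).
    exact: measurable_expRM.
  exact: measurable_snd.
have k0 z : 0 <= k z by rewrite /k mulr_ge0// mulr_ge0 ?sqr_ge0 ?expR_ge0.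
have kD w x : D x -> k (w, x) = (est w x - F x) ^+ 2 * expR (- (a * x)) * f x.
  move=> Dx; rewrite /k /= mulNr /fD patchE mem_set// ger0_norm//.
  by move: Dx; rewrite DE.
have kND w x : ~ D x -> k (w, x) = 0.
  by move=> Dx; rewrite /k /= /fD patchE memNset// mulr0.
have sq4 (u p : R) : `|u| <= 1 -> 0 <= p <= 1 -> `|(u - p) ^+ 2| <= 4.
  rewrite ler_norml => /andP[? ?] /andP[? ?].
  by rewrite ger0_norm ?sqr_ge0//; nra.
have msec w : measurable_fun D (fun x => (est w x - F x) ^+ 2).
  have h : measurable_fun D (fun x => est w `|x|).
    by apply: measurable_funTS; exact: (measurableT_comp mest (pair1_measurable w)).
  have h' : measurable_fun D (est w).
    apply: eq_measurable_fun h => x; rewrite inE => Dx.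
    by rewrite ger0_norm// -DE.
  by apply: measurable_funX; apply: measurable_funB => //; exact: measurable_funTS.
transitivity (\int[P]_w \int[mu]_x (k (w, x))%:E)%E.
  rewrite /MISE unlock; apply: eq_integral => w _.
  rewrite /Rintegral fineK; last first.
    apply: integrable_fin_num => //.
    apply: (integrable_weighted a_gt0 cf f_bound (_ : 0 <= 4) (msec w)) => // x x0.
    apply: le_trans (sq4 _ _ (est1 w x x0) (F01 x)) _.
    by rewrite ler_peMr// exprn_ege1// lerDl.
  rewrite integral_mkcond; apply: eq_integral => x _.
  rewrite patchE; case: ifPn => [|/negP]; rewrite inE => Dx.
    by rewrite kD.
  by rewrite kND.
have mk' : measurable_fun setT (fun z => (k z)%:E) by exact/measurable_EFinP.
have k0' z : (0 <= (k z)%:E)%E by rewrite lee_fin.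
apply: (eq_trans (@fubini_tonelli _ _ _ _ R P mu (fun z => (k z)%:E) mk' k0')).
rewrite /weighted_integral /Rintegral fineK; last first.
  apply: integrable_fin_num => //.
  exact: (integrable_weighted a_gt0 cf f_bound C0 mv vC).
rewrite [RHS]integral_mkcond; apply: eq_integral => x _.
rewrite patchE; case: ifPn => [|/negP]; rewrite inE => Dx; last first.
  by apply: integral0_eq => w _; rewrite kND.
have x0 : 0 <= x by rewrite -DE.
have bw : bounded_measurable (fun w => (est w x - F x) ^+ 2).
  split; last by exists 4 => w; exact: sq4 (est1 w x x0) (F01 x).
  apply: measurable_funX; apply: measurable_funB; last exact: measurable_cst.
  rewrite (_ : est ^~ x = (fun z : T * R => est z.1 `|z.2|) \o pair^~ x).
    exact: measurableT_comp mest (pair2_measurable x).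
  by apply/funext => w; rewrite /= ger0_norm.
rewrite -estv//.
transitivity (\int[P]_w (expR (- (a * x)) * f x * (est w x - F x) ^+ 2)%:E)%E.
  by apply: eq_integral => w _; rewrite kD//; congr EFin; ring.
have bc := bounded_measurable_cst T (expR (- (a * x)) * f x).
rewrite -[LHS]fineK; last first.
  exact/integrable_fin_num/bounded_measurable_integrable/bounded_measurableM.
rewrite -[fine _]/(\int[P]_w (expR (- (a * x)) * f x * (est w x - F x) ^+ 2)).
by rewrite bounded_RintegralZ//; congr EFin; ring.
Qed.

End mise.

(** * Joint measurability of the estimators and measurability of the smoothed moments *)

Section measurability_in_x.
Context d (T : measurableType d) (R : realType) (P : probability T R).
Variables (X : nat -> {RV P >-> R}) (F : R -> R).
Hypothesis X_iid : iid_with_cdf X F.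

Local Notation D := (`[0, +oo[%classic : set R).

Lemma measurable_pois (c : R) k : measurable_fun setT (fun x => pois (c * x) k).
Proof.
apply: measurable_funM; last exact: measurable_cst.
apply: measurable_funM.
  have -> : (fun x => expR (- (c * x))) = (fun x => expR (- c * x)).
    by apply/funext => x; rewrite mulNr.
  exact: measurable_expRM.
by apply: measurable_funX; apply: measurable_funM => //; exact: measurable_cst.
Qed.

Lemma measurable_ecdf_joint n :
  measurable_fun setT (fun z : T * R => ecdf X n z.1 `|z.2|).
Proof.
apply: measurable_funM; first exact: measurable_cst.
apply: measurable_sum => i.
pose h (z : T * R) := X i z.1 - `|z.2|.
have mh : measurable_fun setT h.
  apply: measurable_funB.
    by apply: (measurableT_comp (f := X i)) => //; exact: measurable_fst.
  by apply: measurableT_comp; [exact: normr_measurable|exact: measurable_snd].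
have -> : (fun z : T * R => (X i z.1 <= `|z.2|)%R%:R) = \1_(h @^-1` `]-oo, 0]) :> (_ -> R).
  apply/funext => z; rewrite indicE; congr ((nat_of_bool _)%:R).
  by apply/idP/idP; rewrite inE /h /= in_itv/= subr_le0.
apply: measurable_indic; rewrite -[X in measurable X]setTI; exact: mh.
Qed.

(** The argument [|z.2|] is nonnegative, so the partial sums converge at every point of the product
    and measurability passes to the limit. *)
Lemma measurable_szasz_joint m n :
  measurable_fun setT (fun z : T * R => szasz X m n z.1 `|z.2|).
Proof.
under eq_fun do rewrite szaszE//.
apply: measurable_funM; first exact: measurable_cst.
apply: measurable_sum => i.
apply: (@measurable_fun_cvg _ _ _ _ (fun N (z : T * R) => szasz_partial X m `|z.2| i N z.1));
  last by move=> z _; exact: szasz_partial_cvg.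
move=> N; apply: measurable_sum => k; apply: measurable_funM.
  apply: (measurableT_comp (f := below X i (k%:R / m%:R))); last exact: measurable_fst.
  by have [] := bounded_measurable_below X i (k%:R / m%:R).
apply: (measurableT_comp (measurable_pois m%:R k)).
by apply: measurableT_comp; [exact: normr_measurable|exact: measurable_snd].
Qed.

Lemma measurable_smooth_mean m : measurable_fun D (smooth_mean F m).
Proof.
have h N : measurable_fun D (fun x => psum (m%:R * x) (fun k => F (k%:R / m%:R)) N).
  apply: measurable_sum => k; apply: measurable_funM; first exact: measurable_cst.
  apply: measurable_funTS; exact: measurable_pois.
apply: (measurable_fun_cvg h) => x; rewrite /= in_itv/= andbT => x0.
exact: (smooth_mean_cvg X_iid (m := m) x0).
Qed.

Lemma measurable_smooth_mean2 m : measurable_fun D (smooth_mean2 F m).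
Proof.
have h N : measurable_fun D
    (fun x => psum2 (m%:R * x) (fun k l => F ((minn k l)%:R / m%:R)) N).
  apply: measurable_sum => k; apply: measurable_sum => l.
  apply: measurable_funM; first exact: measurable_cst.
  by apply: measurable_funM; apply: measurable_funTS; exact: measurable_pois.
apply: (measurable_fun_cvg h) => x; rewrite /= in_itv/= andbT => x0.
exact: (smooth_mean2_cvg X_iid (m := m) x0).
Qed.

Lemma cdf_norm_le1 t : `|F t| <= 1.
Proof. by have /andP[F0 F1] := cdf_bounds X_iid t; rewrite ger0_norm. Qed.

Lemma smooth_mean_norm_le1 m x : 0 <= x -> `|smooth_mean F m x| <= 1.
Proof.
move=> x0; have mx0 : 0 <= m%:R * x by rewrite mulr_ge0.
exact: psum_norm_le mx0 (fun k => cdf_norm_le1 _)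
  (smooth_mean_cvg X_iid (m := m) x0) (@psum_cst1 R _).
Qed.

Lemma smooth_mean2_norm_le1 m x : 0 <= x -> `|smooth_mean2 F m x| <= 1.
Proof.
move=> x0; have mx0 : 0 <= m%:R * x by rewrite mulr_ge0.
apply: (ler_cvg_to (cvg_norm (smooth_mean2_cvg X_iid (m := m) x0)) (cvg_cst (1 : R))).
apply: nearW => N.
have h : `|psum2 (m%:R * x) (fun k l => F ((minn k l)%:R / m%:R)) N| <=
    psum2 (m%:R * x) (fun _ _ => 1 * 1) N.
  by apply: psum2_norm_le => // k l; rewrite mulr1 cdf_norm_le1.
apply: le_trans h _; rewrite (psum2_prod _ (fun=> 1) (fun=> 1)).
have p1 : psum (m%:R * x) (fun=> 1) N <= 1 by exact: psum_le_lim mx0 _ (@psum_cst1 R _).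
rewrite mulr_ile1// sumr_ge0// => k _; by rewrite mul1r pois_ge0.
Qed.

End measurability_in_x.

Lemma equals_scaled_o1_near (R : realType) (u v s : nat -> R) (l : R) :
  (\forall n \near \oo, u n = v n) -> equals_scaled_o1 u s l -> equals_scaled_o1 v s l.
Proof.
move=> uv [e e0 ue]; exists e => //; near=> n.
by rewrite -(near uv n)//; near: n.
Unshelve. all: by end_near. Qed.

(** * Deficiency of the empirical distribution function *)

Lemma mean_norm_le1 (R : realFieldType) n (y : nat -> R) : (forall i, `|y i| <= 1) ->
  `|n%:R^-1 * \sum_(i < n) y i| <= 1.
Proof.
move=> y1; case: n => [|n]; first by rewrite invr0 mul0r normr0 ler01.
rewrite normrM ger0_norm ?invr_ge0// ler_pdivrMl ?ltr0n// mulr1.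
apply: le_trans (ler_norm_sum _ _ _) _.
apply: (@le_trans _ _ (\sum_(i < n.+1) 1)); first by apply: ler_sum => i _; exact: y1.
by rewrite sumr_const card_ord.
Qed.

Section deficiency_of_szasz.
Context d (T : measurableType d) (R : realType) (P : probability T R).
Variables (X : nat -> {RV P >-> R}) (F f f' : R -> R) (a : R) (m : nat -> nat).
Hypotheses (X_iid : iid_with_cdf X F) (F0 : F 0 = 0) (F_cont : continuous F)
  (F_deriv : halfline_derivative F f) (f_deriv : halfline_derivative f f')
  (f_reg : halfline_cont_bounded f) (f'_reg : halfline_cont_bounded f')
  (a_gt0 : 0 < a) (m_gt0 : forall n, (0 < m n)%N) (m_oo : m @ \oo --> \oo).

Local Notation D := (`[0, +oo[%classic : set R).

(** The variance of the Szasz estimator multiplied by the sample size. *)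
Let variance k x := smooth_mean2 F k x - smooth_mean F k x ^+ 2.
Let sq_bias k x := (smooth_mean F k x - F x) ^+ 2.

Let cF : {within `[0, +oo[, continuous F}.
Proof. exact: continuous_subspaceT. Qed.

Let mF : measurable_fun D F.
Proof. by apply: measurable_funTS; exact: continuous_measurable_fun. Qed.

Let f_ge0 x : 0 <= x -> 0 <= f x.
Proof.
move=> x0; rewrite leNgt; apply/negP => fx.
(* With half of |f x| as tolerance, the increment of [F] to the right of [x] would be negative,
   against monotonicity; a point to the right is available at 0 too. *)
have nf : 0 < - f x / 2 by rewrite divr_gt0// oppr_gt0.
have [del del0 H] := halfline_derivativeP F_deriv x0 nf.
have d2 : 0 < del / 2 by rewrite divr_gt0.
have xd : 0 <= x + del / 2 by rewrite addr_ge0// ltW.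
have e : x + del / 2 - x = del / 2 by rewrite addrAC subrr add0r.
have := H _ xd; rewrite e gtr0_norm// => /(_ ltac:(lra)).
rewrite ler_norml => /andP[_].
have : F x <= F (x + del / 2) by apply: (cdf_monotone X_iid); rewrite lerDl ltW.
nra.
Qed.

Let F_bounds x : 0 <= F x <= 1. Proof. exact: cdf_bounds X_iid x. Qed.

(** The difference sigma2 - variance is (F - M2) + (M1 - F) (M1 + F). The second part is at most 2 M
    x / k, where [M] bounds f'. The constant [C] precedes [k] and [x], so that the estimate can also
    dominate under the integral. *)
Lemma variance_expansion : exists2 C, 0 <= C & forall k x, (0 < k)%N -> 0 <= x ->
  `|Num.sqrt k%:R * (sigma2 F x - variance k x) - VS f x| <= C * (1 + x) / Num.sqrt k%:R.
Proof.
have [M1 M10 fM] := halfline_bounded f_reg; have [M2 M20 f'M] := halfline_bounded f'_reg.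
exists (4 * M2 + 2 * M1); first by rewrite addr_ge0// mulr_ge0.
move=> k x k0 x0; have q0 : 0 < Num.sqrt k%:R :> R by rewrite sqrtr_gt0 ltr0n.
have q2 : k%:R = Num.sqrt k%:R ^+ 2 :> R by rewrite sqr_sqrtr.
have [cf _] := f_reg.
have h1 := smoothing_second_moment cF cf F_deriv f_deriv f'M k0 x0
  (smooth_mean2_cvg X_iid (m := k) x0).
have h2 := smoothing_bias_bound cF cf F_deriv f_deriv f'M k0 x0
  (smooth_mean_cvg X_iid (m := k) x0).
have /andP[F_0 F_1] := F_bounds x.
have := smooth_mean_norm_le1 X_iid k x0; rewrite ler_norml => /andP[M_0 M_1].
have h3 : `|smooth_mean F k x + F x| <= 2 by rewrite ler_norml; apply/andP; split; lra.
set q := Num.sqrt k%:R in q0 q2 h1 *.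
have -> : q * (sigma2 F x - variance k x) - VS f x =
    (q * (F x - smooth_mean2 F k x) - VS f x) +
    q * ((smooth_mean F k x - F x) * (smooth_mean F k x + F x)).
  by rewrite /sigma2 /variance; ring.
have h4 : `|q * ((smooth_mean F k x - F x) * (smooth_mean F k x + F x))| <=
    2 * M2 * x / q.
  rewrite !normrM (gtr0_norm q0).
  apply: (@le_trans _ _ (q * (M2 * x / k%:R * 2))).
    by rewrite ler_pM2l// ler_pM.
  by rewrite le_eqVlt; apply/orP; left; apply/eqP; rewrite q2; field; rewrite gt_eqF.
apply: le_trans (ler_normD _ _) _; apply: le_trans (lerD h1 h4) _.
rewrite -mulrDl ler_wpM2r ?invr_ge0 ?(ltW q0)//.
have := fM x x0; have := mulr_ge0 M10 x0; have := mulr_ge0 M20 x0; lra.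
Qed.

Lemma sqrtm_inv_cvg0 (K : R) : K / Num.sqrt (m n)%:R @[n --> \oo] --> (0 : R).
Proof.
have p2 : 0 < 2^-1 :> R by [].
have mr : ((m n)%:R : R) @[n --> \oo] --> +oo by exact/cvgrnyP.
rewrite -[X in _ --> X](mulr0 K); apply: cvgnM; first exact: cvg_cst.
apply: near_cvgn (powRN_cvg0 p2 mr) _; near=> n.
by rewrite powRN powR12_sqrt.
Unshelve. all: by end_near. Qed.

Lemma variance_limit x : 0 <= x ->
  Num.sqrt (m n)%:R * (sigma2 F x - variance (m n) x) @[n --> \oo] --> VS f x.
Proof.
move=> x0; have [C C0 HC] := variance_expansion.
rewrite -[VS f x]addr0.
have h : (Num.sqrt (m n)%:R * (sigma2 F x - variance (m n) x) - VS f x) @[n --> \oo] --> (0 : R).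
  apply/norm_cvg0P.
  apply: (@squeeze_cvgr _ _ _ _ (fun=> 0) (fun n => C * (1 + x) / Num.sqrt (m n)%:R)).
  - by near=> n; rewrite normr_ge0 HC.
  - exact: cvg_cst.
  - exact: sqrtm_inv_cvg0.
apply: near_cvgn (cvgnD (cvg_cst (VS f x)) h) _; near=> n.
by rewrite subrKC.
Unshelve. all: by end_near. Qed.

Lemma sq_bias_limit x : 0 <= x ->
  (m n)%:R ^+ 2 * sq_bias (m n) x @[n --> \oo] --> bS f' x ^+ 2.
Proof.
move=> x0; have [M2 _ f'M] := halfline_bounded f'_reg; have [cf _] := f_reg.
have h := smoothing_bias_limit cF cf F_deriv f_deriv f'M m_gt0 m_oo x0
  (fun n => smooth_mean_cvg X_iid (m := m n) x0).
apply: near_cvgn (cvgnM h h) _; near=> n.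
by rewrite -expr2 exprMn.
Unshelve. all: by end_near. Qed.

Lemma measurable_variance k : measurable_fun D (variance k).
Proof.
apply: measurable_funB; first exact: measurable_smooth_mean2 X_iid _.
by apply: measurable_funX; exact: measurable_smooth_mean X_iid _.
Qed.

Lemma measurable_sq_bias k : measurable_fun D (sq_bias k).
Proof.
apply: measurable_funX; apply: measurable_funB => //.
exact: measurable_smooth_mean X_iid _.
Qed.

Lemma measurable_sigma2 : measurable_fun D (sigma2 F).
Proof.
by apply: measurable_funM => //; apply: measurable_funB => //; exact: measurable_cst.
Qed.

Let quad_ge1 (x : R) : 0 <= x -> 1 <= (1 + x) ^+ 2.
Proof. by move=> x0; rewrite exprn_ege1// lerDl. Qed.

Lemma variance_norm_le k x : 0 <= x -> `|variance k x| <= 4 * (1 + x) ^+ 2.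
Proof.
move=> x0; have := quad_ge1 x0.
have := smooth_mean_norm_le1 X_iid k x0; have := smooth_mean2_norm_le1 X_iid k x0.
rewrite /variance !ler_norml => /andP[? ?] /andP[? ?] ?; apply/andP; split; nra.
Qed.

Lemma sq_bias_norm_le k x : 0 <= x -> `|sq_bias k x| <= 4 * (1 + x) ^+ 2.
Proof.
move=> x0; have := quad_ge1 x0; have /andP[? ?] := F_bounds x.
have := smooth_mean_norm_le1 X_iid k x0.
rewrite /sq_bias !ler_norml => /andP[? ?] ?; apply/andP; split; nra.
Qed.

Lemma sigma2_norm_le x : 0 <= x -> `|sigma2 F x| <= 4 * (1 + x) ^+ 2.
Proof.
move=> x0; have := quad_ge1 x0; have /andP[? ?] := F_bounds x.
rewrite /sigma2 !ler_norml => ?; apply/andP; split; nra.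
Qed.

Let int_variance n := weighted_integral f a (variance (m n)).
Let int_sq_bias n := weighted_integral f a (sq_bias (m n)).

(** Dominated convergence; the majorant adds the error of [variance_expansion] to [VS f x], for
    which sqrt (x / pi) <= 1 + x. *)
Lemma int_variance_limit :
  Num.sqrt (m n)%:R * (C1S F f a - int_variance n) @[n --> \oo] --> C2S f a.
Proof.
have [M1 M10 fM] := halfline_bounded f_reg; have [cf _] := f_reg.
have [C C0 HC] := variance_expansion.
have c40 : 0 <= 4 :> R by [].
have mv n : measurable_fun D (fun x => -1 * variance (m n) x).
  by apply: measurable_funM; [exact: measurable_cst|exact: measurable_variance].
have CM0 : 0 <= C + M1 by rewrite addr_ge0.
have G_le n x : 0 <= x ->
    `|Num.sqrt (m n)%:R * (sigma2 F x - variance (m n) x)| <= (C + M1) * (1 + x) ^+ 2.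
  move=> x0; have q1 : 1 <= Num.sqrt (m n)%:R :> R.
    by rewrite -[leLHS]sqrtr1 ler_wsqrtr// ler1n.
  have h1 : C * (1 + x) / Num.sqrt (m n)%:R <= C * (1 + x).
    by rewrite ler_pdivrMr ?(lt_le_trans ltr01)// ler_peMr// mulr_ge0// addr_ge0.
  have h2 : `|VS f x| <= M1 * (1 + x).
    rewrite normrM ler_pM ?fM// ger0_norm ?sqrtr_ge0//.
    have x10 : 0 <= 1 + x by rewrite addr_ge0.
    rewrite -[leRHS](ger0_norm x10) -sqrtr_sqr ler_wsqrtr//.
    rewrite ler_pdivrMr ?pi_gt0//.
    have := pi_ge2 R; have := sqr_ge0 x; rewrite sqrrD; nra.
  have h3 := HC _ _ (m_gt0 n) x0.
  rewrite -[X in `|X|](subrK (VS f x)) (le_trans (ler_normD _ _))//.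
  have : (C + M1) * (1 + x) <= (C + M1) * (1 + x) ^+ 2.
    by rewrite ler_wpM2l// expr2 ler_peMr ?addr_ge0// lerDl.
  lra.
apply: near_cvgn (weighted_integral_cvg a_gt0 cf fM CM0 _ G_le variance_limit) _.
  move=> n; apply: measurable_funM; first exact: measurable_cst.
  by apply: measurable_funB; [exact: measurable_sigma2|exact: measurable_variance].
near=> n.
have nv x : 0 <= x -> `|-1 * variance (m n) x| <= 4 * (1 + x) ^+ 2.
  by move=> x0; rewrite mulN1r normrN variance_norm_le.
rewrite /int_variance /C1S.
have -> : weighted_integral f a (sigma2 F) - weighted_integral f a (variance (m n)) =
    weighted_integral f a (fun x => sigma2 F x - variance (m n) x).
  rewrite -mulN1r -(weighted_integralZ a_gt0 cf fM _ c40 (measurable_variance _)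
    (@variance_norm_le _)).
  rewrite -(weighted_integralD a_gt0 cf fM c40 measurable_sigma2 (mv n) sigma2_norm_le nv).
  by congr weighted_integral; apply/funext => x; rewrite mulN1r.
have c80 : 0 <= 8 :> R by [].
rewrite -(weighted_integralZ a_gt0 cf fM (C := 8))//.
  by apply: measurable_funB; [exact: measurable_sigma2|exact: measurable_variance].
move=> x x0; have := sigma2_norm_le x0; have := variance_norm_le (m n) x0.
by move=> ? ?; rewrite (le_trans (ler_normB _ _))//; lra.
Unshelve. all: by end_near. Qed.

(** The scaled squared bias is dominated by (M x) ^ 2, with [M] a bound of f', through
    [smoothing_bias_bound]. *)
Lemma int_sq_bias_limit :
  (m n)%:R ^+ 2 * int_sq_bias n @[n --> \oo] --> C3S f f' a.
Proof.
have [M1 M10 fM] := halfline_bounded f_reg; have [cf _] := f_reg.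
have [M2 M20 f'M] := halfline_bounded f'_reg.
have c40 : 0 <= 4 :> R by [].
have M220 := sqr_ge0 M2.
have G_le n x : 0 <= x -> `|(m n)%:R ^+ 2 * sq_bias (m n) x| <= M2 ^+ 2 * (1 + x) ^+ 2.
  move=> x0; have mn0 : 0 < (m n)%:R :> R by rewrite ltr0n.
  have := smoothing_bias_bound cF cf F_deriv f_deriv f'M (m_gt0 n) x0
    (smooth_mean_cvg X_iid (m := m n) x0).
  rewrite ler_pdivlMr// => h.
  rewrite /sq_bias -!exprMn normrX; apply: lerXn2r; rewrite ?nnegrE ?normr_ge0//.
    by rewrite mulr_ge0// addr_ge0.
  rewrite normrM gtr0_norm// mulrC (le_trans h)// ler_wpM2l// lerDr//.
apply: near_cvgn (weighted_integral_cvg a_gt0 cf fM M220 _ G_le sq_bias_limit) _.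
  move=> n; apply: measurable_funM; first exact: measurable_cst.
  exact: measurable_sq_bias.
near=> n.
exact: (weighted_integralZ a_gt0 cf fM _ c40 (measurable_sq_bias _) (@sq_bias_norm_le _)).
Unshelve. all: by end_near. Qed.

(** A point is needed where [sigma2 F] and [f] are positive together. Between points with F = 1/4
    and F = 3/4 the mean value theorem finds one with f > 0, and there F stays in [1/4, 3/4]. *)
Lemma C1S_gt0 : 0 < C1S F f a.
Proof.
have [M1 M10 fM] := halfline_bounded f_reg; have [cf _] := f_reg.
have c40 : 0 <= 4 :> R by [].
have [y Fy y0] : exists2 y, 3 / 4 < F y & 0 < y.
  have cvF : F @ +oo --> (1 : R).
    have := cvg_cdfy1 (X 0); rewrite (_ : cdf (X 0) = EFin \o F); last first.
      by apply/funext => t; have [_ ->] := X_iid.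
    by move/fine_cvg.
  have H : \forall y \near +oo, 3 / 4 < F y by apply: (cvgr_gt _ cvF); lra.
  have /filter_ex[y [Fy y0]] : \forall y \near +oo, 3 / 4 < F y /\ 0 < y.
    by near=> y; split; near: y; [exact: H|exact: nbhs_pinfty_gt].
  by exists y.
have ivt v : 0 < v -> v < F y -> exists2 c, 0 < c & F c = v.
  move=> v0 vy; have [|c] := @IVT _ F 0 y v (ltW y0) (continuous_subspaceT F_cont).
    by rewrite F0 ge_min le_max (ltW v0) (ltW vy) orbT.
  rewrite in_itv/= => /andP[c0 _] Fc; exists c => //.
  rewrite lt_neqAle c0 andbT; apply/eqP => c0'.
  by move: Fc v0; rewrite -c0' F0 => <-; rewrite ltxx.
have [z1 z10 Fz1] : exists2 c, 0 < c & F c = 1 / 4 by apply: ivt; lra.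
have [z2 z20 Fz2] : exists2 c, 0 < c & F c = 3 / 4 by apply: ivt; lra.
have z12 : z1 < z2.
  by rewrite ltNge; apply/negP => /(cdf_monotone X_iid); rewrite Fz1 Fz2; lra.
have [|c|c] := @MVT _ F f z1 z2 z12.
- by move=> c; rewrite in_itv/= => /andP[zc _]; apply: halfline_is_derive => //; exact: lt_trans zc.
- exact: continuous_subspaceT.
rewrite in_itv/= => /andP[zc cz] e.
have c0 : 0 < c by exact: lt_trans zc.
have Fc1 : 1 / 4 <= F c by rewrite -Fz1; apply: (cdf_monotone X_iid); exact: ltW.
have Fc2 : F c <= 3 / 4 by rewrite -Fz2; apply: (cdf_monotone X_iid); exact: ltW.
have fc : 0 < f c.
  have : 0 < f c * (z2 - z1) by rewrite -e Fz1 Fz2; lra.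
  by rewrite pmulr_lgt0// subr_gt0.
apply: (weighted_integral_gt0 a_gt0 cf fM c40 measurable_sigma2 sigma2_norm_le _ f_ge0 c0 _ fc).
- by move=> x _; have /andP[? ?] := F_bounds x; rewrite mulr_ge0// subr_ge0.
- by rewrite /sigma2; nra.
- apply: cvgM; first exact: F_cont.
  by apply: cvgB; [exact: cvg_cst|exact: F_cont].
- exact: is_derive_continuous (halfline_is_derive f_deriv c0).
Unshelve. all: by end_near. Qed.

Lemma iG_eq n : (0 < n)%N -> iG X F f a (m n) n =
  nat_min [set k | (0 < k)%N /\ C1S F f a / k%:R <= int_variance n / n%:R + int_sq_bias n].
Proof.
move=> n0; have [M1 M10 fM] := halfline_bounded f_reg; have [cf _] := f_reg.
have c40 : 0 <= 4 :> R by [].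
have ecdf1 k w x : 0 <= x -> `|ecdf X k w x| <= 1.
  by move=> _; exact: (mean_norm_le1 k (fun i => below_norm_le1 X i x w)).
have szasz1 w x : 0 <= x -> `|szasz X (m n) n w x| <= 1.
  by move=> x0; rewrite szaszE//;
    exact: (mean_norm_le1 n (fun i => szasz_term_norm_le1 X (m n) i w x0)).
have nr1 k : (0 < k)%N -> k%:R^-1 <= 1 :> R.
  by move=> k0; rewrite invf_le1 ?ler1n ?ltr0n.
have E k : (0 < k)%N -> MISE P (ecdf X k) F f a = (C1S F f a / k%:R)%:E.
  move=> k0; rewrite (MISE_weighted a_gt0 F_cont F_bounds cf fM f_ge0 c40 (ecdf1 k)
    (measurable_ecdf_joint X k) (v := fun x => k%:R^-1 * sigma2 F x)).
  - congr EFin; rewrite [RHS]mulrC.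
    exact: (weighted_integralZ a_gt0 cf fM _ c40 measurable_sigma2 sigma2_norm_le).
  - by move=> x x0; rewrite (ecdf_mean_square_error X_iid)// mulrC.
  - by apply: measurable_funM; [exact: measurable_cst|exact: measurable_sigma2].
  - move=> x x0; rewrite normrM ger0_norm//.
    by apply: le_trans (sigma2_norm_le x0); rewrite ler_piMl ?nr1.
have S : MISE P (szasz X (m n) n) F f a = (int_variance n / n%:R + int_sq_bias n)%:E.
  have c80 : 0 <= 8 :> R by [].
  have bv x : 0 <= x -> `|n%:R^-1 * variance (m n) x| <= 4 * (1 + x) ^+ 2.
    move=> x0; rewrite normrM ger0_norm//.
    by apply: le_trans (variance_norm_le (m n) x0); rewrite ler_piMl ?nr1.
  have mv : measurable_fun D (fun x => n%:R^-1 * variance (m n) x).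
    by apply: measurable_funM; [exact: measurable_cst|exact: measurable_variance].
  rewrite (MISE_weighted a_gt0 F_cont F_bounds cf fM f_ge0 c80 szasz1
    (measurable_szasz_joint X (m n) n)
    (v := fun x => n%:R^-1 * variance (m n) x + sq_bias (m n) x)).
  - congr EFin.
    rewrite (weighted_integralD a_gt0 cf fM c40 mv (measurable_sq_bias _) bv (@sq_bias_norm_le _)).
    rewrite (weighted_integralZ a_gt0 cf fM _ c40 (measurable_variance _) (@variance_norm_le _)).
    by rewrite [_ / _]mulrC.
  - by move=> x x0; rewrite (szasz_mean_square_error X_iid)// [_ / _]mulrC.
  - by apply: measurable_funD => //; exact: measurable_sq_bias.
  - move=> x x0; have := bv x x0; have := sq_bias_norm_le (m n) x0.
    by move=> ? ?; rewrite (le_trans (ler_normD _ _))//; lra.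
by rewrite /iG; congr nat_min; apply/seteqP; split => k /= [k0];
  rewrite E// S lee_fin; split.
Qed.

End deficiency_of_szasz.

Lemma deficiency_regimes (R : realType) (s V b : R) (m : nat -> nat) (A B : nat -> R)
    (i : nat -> nat) :
  0 < s -> (forall n, (0 < m n)%N) -> m @ \oo --> \oo ->
  Num.sqrt (m n)%:R * (s - A n) @[n --> \oo] --> V ->
  (m n)%:R ^+ 2 * B n @[n --> \oo] --> b ->
  (forall n, (0 < n)%N ->
    i n = nat_min [set k | (0 < k)%N /\ s / k%:R <= A n / n%:R + B n]) ->
  [/\ ((m n)%:R * n%:R `^ (- (1 / 2)) : R) @[n --> \oo] --> +oo ->
        equals_scaled_o1 (fun n => (i n)%:R) (fun n => n%:R) (1 : R),
      ((m n)%:R * n%:R `^ (- (2 / 3)) : R) @[n --> \oo] --> +oo ->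
      ((m n)%:R * n%:R `^ (- 2) : R) @[n --> \oo] --> 0 ->
        equals_scaled_o1 (fun n => (i n)%:R - n%:R)
          (fun n => (m n)%:R `^ (- (1 / 2)) * n%:R) (V / s) &
      forall c : R, 0 < c ->
      ((m n)%:R * n%:R `^ (- (2 / 3)) : R) @[n --> \oo] --> c ->
        equals_scaled_o1 (fun n => (i n)%:R - n%:R) (fun n => n%:R `^ (2 / 3))
          (c `^ (- (1 / 2)) * (V / s) - c `^ (- 2) * (b / s))].
Proof.
move=> s0 m0 moo AV Bb iE.
(* [i n] is known to be this minimum only for [0 < n], while the rate lemmas ask for [u_ratio] at
   every [n]; hence the detour through [u], which agrees with [i] eventually. *)
pose u n := nat_min [set k | (0 < k)%N /\ s / k%:R <= A n / n%:R + B n].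
have u_ratio n (M0 : 0 < A n / n%:R + B n) := nat_min_ratio s0 M0.
have ui : \forall n \near \oo, (u n)%:R = (i n)%:R :> R.
  by near=> n; rewrite iE//; near: n; exact: nbhs_infty_gt.
have uin : \forall n \near \oo, (u n)%:R - n%:R = (i n)%:R - n%:R :> R.
  by near=> n; congr (_ - _); near: n; exact: ui.
split.
- by move=> h; apply: equals_scaled_o1_near ui _; exact: (deficiency_first_order s0 m0 moo AV Bb).
- by move=> h h2; apply: equals_scaled_o1_near uin _;
  exact: (deficiency_rate_variance s0 m0 moo AV Bb).
- by move=> c c0 h; apply: equals_scaled_o1_near uin _;
  exact: (deficiency_rate_balanced s0 m0 moo AV Bb).
Unshelve. all: by end_near. Qed.

(** The guard [0 < F x < 1] makes [sigma2 F x] positive, so that [thetaS] and [gammaS] are genuine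
    quotients; where [sigma2] vanishes, a single observation already has zero error. The global
    statements rest on [C1S_gt0]. *)
Theorem theorem8 (R : realType) (d : measure_display) (T : measurableType d)
    (P : probability T R) (X : nat -> {RV P >-> R}) (F f f' : R -> R)
    (a : R) (m : nat -> nat) (x : R)
    (X_ge0 : forall i w, 0 <= X i w)
    (X_iid : iid_with_cdf X F)
    (F0 : F 0 = 0)
    (F_cont : continuous F)
    (F_deriv : halfline_derivative F f)
    (f_deriv : halfline_derivative f f')
    (f_reg : halfline_cont_bounded f)
    (f'_reg : halfline_cont_bounded f')
    (a_gt0 : 0 < a)
    (m_gt0 : forall n, (0 < m n)%N)
    (m_oo : m @ \oo --> \oo)
    (x_gt0 : 0 < x) :
  [/\ ((m n)%:R * n%:R `^ (- (1 / 2)) : R) @[n --> \oo] --> +oo ->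
        (0 < F x < 1 ->
          equals_scaled_o1 (fun n => (iL X F (m n) n x)%:R)
            (fun n => n%:R) (1 : R)) /\
        equals_scaled_o1 (fun n => (iG X F f a (m n) n)%:R)
          (fun n => n%:R) (1 : R),
      ((m n)%:R * n%:R `^ (- (2 / 3)) : R) @[n --> \oo] --> +oo ->
      ((m n)%:R * n%:R `^ (- 2) : R) @[n --> \oo] --> 0 ->
        (0 < F x < 1 ->
          equals_scaled_o1 (fun n => (iL X F (m n) n x)%:R - n%:R)
            (fun n => (m n)%:R `^ (- (1 / 2)) * n%:R) (thetaS F f x)) /\
        equals_scaled_o1 (fun n => (iG X F f a (m n) n)%:R - n%:R)
          (fun n => (m n)%:R `^ (- (1 / 2)) * n%:R) (C2S f a / C1S F f a) &
      forall c : R, 0 < c ->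
      ((m n)%:R * n%:R `^ (- (2 / 3)) : R) @[n --> \oo] --> c ->
        (0 < F x < 1 ->
          equals_scaled_o1 (fun n => (iL X F (m n) n x)%:R - n%:R)
            (fun n => n%:R `^ (2 / 3))
            (c `^ (- (1 / 2)) * thetaS F f x - c `^ (- 2) * gammaS F f' x)) /\
        equals_scaled_o1 (fun n => (iG X F f a (m n) n)%:R - n%:R)
          (fun n => n%:R `^ (2 / 3))
          (c `^ (- (1 / 2)) * (C2S f a / C1S F f a) -
           c `^ (- 2) * (C3S f f' a / C1S F f a))].
Proof.
have sq_bias_lim := sq_bias_limit X_iid F_cont F_deriv f_deriv f_reg f'_reg m_gt0 m_oo.
have variance_lim := variance_limit X_iid F_cont F_deriv f_deriv f_reg f'_reg m_gt0 m_oo.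
have [G1 G2 G3] := deficiency_regimes
  (C1S_gt0 X_iid F0 F_cont F_deriv f_deriv f_reg a_gt0) m_gt0 m_oo
  (int_variance_limit X_iid F_cont F_deriv f_deriv f_reg f'_reg a_gt0 m_gt0 m_oo)
  (int_sq_bias_limit X_iid F_cont F_deriv f_deriv f_reg f'_reg a_gt0 m_gt0 m_oo)
  (iG_eq m X_iid F_cont F_deriv f_reg a_gt0).
have L (s0 : 0 < sigma2 F x) := deficiency_regimes
  s0 m_gt0 m_oo (variance_lim x (ltW x_gt0)) (sq_bias_lim x (ltW x_gt0))
  (fun n n0 => iL_eq X_iid (m n) n0 (ltW x_gt0)).
have s0 : 0 < F x < 1 -> 0 < sigma2 F x.
  by move=> /andP[? ?]; rewrite mulr_gt0// subr_gt0.
split=> [h|h h2|c c0 h]; (split; [move=> Fx; have [L1 L2 L3] := L (s0 Fx)|]).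
- exact: L1.
- exact: G1.
- exact: L2.
- exact: G2.
- exact: L3.
- exact: G3.
Qed.
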